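(* Let $n\ge2$, $\Lambda=\mathbb{Z}[u_{ijk}:1\le i\le2,\ 1\le j,k\le n]$, and let $c=\det(\mathcal{C}_1x_1+\mathcal{C}_2x_2)$ where $\mathcal{C}_i$ is the $n\times n$ matrix with $(j,k)$ entry $u_{ijk}$. Let $T_{\mathcal{C}(x)}\subset\mathbb{P}^1_\Lambda$ be the subscheme cut out by $c$ and $R_c=\Gamma(T_{\mathcal{C}(x)},\mathcal{O})$. Let $T_{\mathcal{C}(y)}\subset\mathbb{P}^{n-1}_\Lambda$ (coordinates $y_1,\dots,y_n$) be the subscheme cut out by the $2\times2$ minors of the $2\times n$ matrix $\mathcal{C}(y)$ whose $(i,k)$ entry is $\sum_ju_{ijk}y_j$. Then $\Gamma(T_{\mathcal{C}(y)},\mathcal{O})$ is isomorphic to $R_c$ as a $\Lambda$-algebra. *)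

(* Defs.v *)
From HB Require Import structures.
From mathcomp Require Import all_boot all_order all_algebra.
From mathcomp Require Import generic_quotient ring boolp.
From mathcomp Require Import mpoly.

Set Implicit Arguments.
Unset Strict Implicit.
Unset Printing Implicit Defensive.

Import GRing.Theory.

Local Open Scope ring_scope.
Local Open Scope quotient_scope.

(* For a comNzRingType R and a sequence F of homogeneous polynomials in
   S := {mpoly R[m]}, let T be the closed subscheme of Proj S = P^(m-1)_R cut
   out by F, that is Proj (S / (F)). This file builds the ring (and R-module)
   of global sections of the structure sheaf of T in the usual way:
   - the points of T are the homogeneous primes p of S that contain F and do
     not contain the irrelevant ideal ('X_0, .., 'X_(m-1));
   - the stalk of O_T at p is the homogeneous localization (S / (F))_(p);
   - a global section assigns to each point an element of its stalk, and is
     locally, in the Zariski topology, given by a single fraction. *)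

Section ClosedSubscheme.
Variables (R : comNzRingType) (m : nat) (F : seq {mpoly R[m]}).
Local Notation S := {mpoly R[m]}.

Definition ideal_gen (a : S) : Prop :=
  exists q : 'I_(size F) -> S, a = \sum_(i < size F) q i * F`_i.

Lemma ideal_gen0 : ideal_gen 0.
Proof. by exists (fun=> 0); rewrite big1 // => i _; rewrite mul0r. Qed.

Lemma ideal_genD a b : ideal_gen a -> ideal_gen b -> ideal_gen (a + b).
Proof.
move=> [q ->] [r ->]; exists (fun i => q i + r i).
by rewrite -big_split /=; apply: eq_bigr => i _; rewrite mulrDl.
Qed.

Lemma ideal_genM c a : ideal_gen a -> ideal_gen (c * a).
Proof.
move=> [q ->]; exists (fun i => c * q i).
by rewrite mulr_sumr; apply: eq_bigr => i _; rewrite mulrA.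
Qed.

(* Properness of a point is a consequence of [pt_relevant]. *)
Record point := Point {
  pt_mem :> S -> Prop;
  pt0 : pt_mem 0;
  ptD : forall a b, pt_mem a -> pt_mem b -> pt_mem (a + b);
  ptM : forall a b, pt_mem b -> pt_mem (a * b);
  pt_prime : forall a b, pt_mem (a * b) -> pt_mem a \/ pt_mem b;
  pt_homog : forall d a, pt_mem a -> pt_mem (pihomog mdeg d a);
  pt_relevant : exists i, ~ pt_mem 'X_i;
  pt_sub : forall f, f \in F -> pt_mem f
}.

(* The closed sets are the V(E) = {p | E is contained in p}. Allowing
   inhomogeneous elements in E gives no more closed sets: as the points are
   homogeneous, E may be replaced by the set of its homogeneous components. *)
Definition zariski_open (U : point -> Prop) : Prop :=
  exists E : S -> Prop, forall p, U p <-> ~ (forall a, E a -> p a).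

Lemma pt1 (p : point) : ~ p 1.
Proof.
case: (pt_relevant p) => i nXi p1; apply: nXi.
by rewrite -['X_i]mulr1; apply: ptM.
Qed.

Section Stalk.
Variable p : point.

Record hfrac := HFrac {
  hnum : S;
  hden : S;
  hdeg : nat;
  hnum_homog : hnum \is hdeg.-homog;
  hden_homog : hden \is hdeg.-homog;
  hdenP : ~ p hden
}.

HB.instance Definition _ := gen_eqMixin hfrac.
HB.instance Definition _ := gen_choiceMixin hfrac.

(* a / f = b / g in S / (F) localized at the homogeneous elements outside p *)
Definition hfrac_equiv (u v : hfrac) : bool :=
  `[< exists h, [/\ h \is homog mdeg, ~ p h
      & ideal_gen (h * (hnum u * hden v - hnum v * hden u))] >].

Lemma hfrac_equivP u v : reflect (exists h, [/\ h \is homog mdeg, ~ p h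
    & ideal_gen (h * (hnum u * hden v - hnum v * hden u))]) (hfrac_equiv u v).
Proof. exact: asboolP. Qed.

Lemma homog1 : (1 : S) \is homog mdeg.
Proof. by apply/homogP; exists 0; apply: dhomog1. Qed.

Lemma homogM (a b : S) :
  a \is homog mdeg -> b \is homog mdeg -> a * b \is homog mdeg.
Proof.
move=> /homogP[d ad] /homogP[e be].
by apply/homogP; exists (d + e)%N; apply: dhomogM.
Qed.

Lemma hdenM_notin (a b : S) : ~ p a -> ~ p b -> ~ p (a * b).
Proof. by move=> pa pb /pt_prime []. Qed.

Lemma hfrac_cross u v :
  hnum u * hden v = hnum v * hden u -> hfrac_equiv u v.
Proof.
move=> uv; apply/hfrac_equivP; exists 1; split; [exact: homog1|exact: pt1|].
by rewrite uv subrr mulr0; apply: ideal_gen0.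
Qed.

Lemma hfrac_equiv_refl : reflexive hfrac_equiv.
Proof. by move=> u; apply: hfrac_cross. Qed.

Lemma hfrac_equiv_sym : ssrbool.symmetric hfrac_equiv.
Proof.
suff imp u v : hfrac_equiv u v -> hfrac_equiv v u.
  by move=> u v; apply/idP/idP; apply: imp.
move=> /hfrac_equivP[h [hh hp hI]]; apply/hfrac_equivP; exists h; split=> //.
have -> : h * (hnum v * hden u - hnum u * hden v) =
          (- 1) * (h * (hnum u * hden v - hnum v * hden u)) by ring.
exact: ideal_genM.
Qed.

Lemma hfrac_equiv_trans : transitive hfrac_equiv.
Proof.
move=> v u w /hfrac_equivP[h [hh hp hI]] /hfrac_equivP[k [kh kp kI]].
apply/hfrac_equivP; exists (h * k * hden v); split.
- apply: homogM; first exact: homogM.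
  by apply/homogP; exists (hdeg v); apply: hden_homog.
- by apply: hdenM_notin (@hdenP v); apply: hdenM_notin.
have -> : h * k * hden v * (hnum u * hden w - hnum w * hden u) =
  k * hden w * (h * (hnum u * hden v - hnum v * hden u)) +
  h * hden u * (k * (hnum v * hden w - hnum w * hden v)) by ring.
by apply: ideal_genD; apply: ideal_genM.
Qed.

Canonical hfrac_equiv_canonical :=
  EquivRel hfrac_equiv hfrac_equiv_refl hfrac_equiv_sym hfrac_equiv_trans.

Definition stalk := {eq_quot hfrac_equiv}.
HB.instance Definition _ : EqQuotient _ hfrac_equiv stalk :=
  EqQuotient.on stalk.
HB.instance Definition _ := Choice.on stalk.

Lemma stalk_eqP u v :
  reflect (\pi_stalk u = \pi_stalk v) (hfrac_equiv u v).
Proof. by apply: (iffP idP) => [h|/eqmodP //]; apply/eqmodP. Qed.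

Lemma hfrac_repr u : hfrac_equiv (repr (\pi_stalk u)) u.
Proof. by apply/stalk_eqP; rewrite reprK. Qed.

Definition hfrac0 : hfrac :=
  HFrac (dhomog0 R mdeg 0) (dhomog1 R mdeg) (@pt1 p).

Definition hfrac1 : hfrac :=
  HFrac (dhomog1 R mdeg) (dhomog1 R mdeg) (@pt1 p).

Lemma hadd_homog u v :
  hnum u * hden v + hnum v * hden u \is (hdeg u + hdeg v).-homog.
Proof.
apply: rpredD; last rewrite addnC; apply: dhomogM;
  by [apply: hnum_homog | apply: hden_homog].
Qed.

Definition hadd u v : hfrac :=
  HFrac (hadd_homog u v) (dhomogM (hden_homog u) (hden_homog v))
        (hdenM_notin (@hdenP u) (@hdenP v)).

Lemma hopp_homog u : - hnum u \is (hdeg u).-homog.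
Proof. by rewrite rpredN; apply: hnum_homog. Qed.

Definition hopp u : hfrac :=
  HFrac (hopp_homog u) (hden_homog u) (@hdenP u).

Definition hmul u v : hfrac :=
  HFrac (dhomogM (hnum_homog u) (hnum_homog v))
        (dhomogM (hden_homog u) (hden_homog v))
        (hdenM_notin (@hdenP u) (@hdenP v)).

Lemma hscale_homog (c : R) u : c *: hnum u \is (hdeg u).-homog.
Proof. by apply: rpredZ; apply: hnum_homog. Qed.

Definition hscale (c : R) u : hfrac :=
  HFrac (hscale_homog c u) (hden_homog u) (@hdenP u).

Lemma hadd_equiv u u' v v' : hfrac_equiv u u' -> hfrac_equiv v v' ->
  hfrac_equiv (hadd u v) (hadd u' v').
Proof.
move=> /hfrac_equivP[h [hh hp hI]] /hfrac_equivP[k [kh kp kI]].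
apply/hfrac_equivP; exists (h * k); split.
- exact: homogM.
- exact: hdenM_notin.
rewrite /=.
have -> : h * k * ((hnum u * hden v + hnum v * hden u) * (hden u' * hden v')
    - (hnum u' * hden v' + hnum v' * hden u') * (hden u * hden v)) =
  (k * hden v * hden v') * (h * (hnum u * hden u' - hnum u' * hden u)) +
  (h * hden u * hden u') * (k * (hnum v * hden v' - hnum v' * hden v)) by ring.
by apply: ideal_genD; apply: ideal_genM.
Qed.

Lemma hmul_equiv u u' v v' : hfrac_equiv u u' -> hfrac_equiv v v' ->
  hfrac_equiv (hmul u v) (hmul u' v').
Proof.
move=> /hfrac_equivP[h [hh hp hI]] /hfrac_equivP[k [kh kp kI]].
apply/hfrac_equivP; exists (h * k); split.
- exact: homogM.
- exact: hdenM_notin.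
rewrite /=.
have -> : h * k * (hnum u * hnum v * (hden u' * hden v')
    - hnum u' * hnum v' * (hden u * hden v)) =
  (k * hnum v * hden v') * (h * (hnum u * hden u' - hnum u' * hden u)) +
  (h * hnum u' * hden u) * (k * (hnum v * hden v' - hnum v' * hden v)) by ring.
by apply: ideal_genD; apply: ideal_genM.
Qed.

Lemma hopp_equiv u u' : hfrac_equiv u u' -> hfrac_equiv (hopp u) (hopp u').
Proof.
move=> /hfrac_equivP[h [hh hp hI]]; apply/hfrac_equivP; exists h; split=> //=.
have -> : h * (- hnum u * hden u' - - hnum u' * hden u) =
  - 1 * (h * (hnum u * hden u' - hnum u' * hden u)) by ring.
exact: ideal_genM.
Qed.

Lemma hscale_equiv c u u' :
  hfrac_equiv u u' -> hfrac_equiv (hscale c u) (hscale c u').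
Proof.
move=> /hfrac_equivP[h [hh hp hI]]; apply/hfrac_equivP; exists h; split=> //=.
have -> : h * (c *: hnum u * hden u' - c *: hnum u' * hden u) =
  c%:MP * (h * (hnum u * hden u' - hnum u' * hden u)).
  by rewrite -!mul_mpolyC; ring.
exact: ideal_genM.
Qed.

Definition stalk_add := lift_op2 stalk hadd.
Lemma pi_stalk_add : {morph \pi : u v / hadd u v >-> stalk_add u v}.
Proof.
move=> u v; unlock stalk_add; apply/stalk_eqP.
by rewrite hfrac_equiv_sym; apply: hadd_equiv; apply: hfrac_repr.
Qed.
Canonical pi_stalk_add_morph := PiMorph2 pi_stalk_add.

Definition stalk_mul := lift_op2 stalk hmul.
Lemma pi_stalk_mul : {morph \pi : u v / hmul u v >-> stalk_mul u v}.
Proof.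
move=> u v; unlock stalk_mul; apply/stalk_eqP.
by rewrite hfrac_equiv_sym; apply: hmul_equiv; apply: hfrac_repr.
Qed.
Canonical pi_stalk_mul_morph := PiMorph2 pi_stalk_mul.

Definition stalk_opp := lift_op1 stalk hopp.
Lemma pi_stalk_opp : {morph \pi : u / hopp u >-> stalk_opp u}.
Proof.
move=> u; unlock stalk_opp; apply/stalk_eqP.
by rewrite hfrac_equiv_sym; apply: hopp_equiv; apply: hfrac_repr.
Qed.
Canonical pi_stalk_opp_morph := PiMorph1 pi_stalk_opp.

Definition stalk_scale (c : R) := lift_op1 stalk (hscale c).
Lemma pi_stalk_scale c : {morph \pi : u / hscale c u >-> stalk_scale c u}.
Proof.
move=> u; unlock stalk_scale; apply/stalk_eqP.
by rewrite hfrac_equiv_sym; apply: hscale_equiv; apply: hfrac_repr.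
Qed.
Canonical pi_stalk_scale_morph c := PiMorph1 (pi_stalk_scale c).

Definition stalk_zero : stalk := \pi_stalk hfrac0.
Definition stalk_one : stalk := \pi_stalk hfrac1.

Lemma stalk_addA : associative stalk_add.
Proof.
elim/quotW=> u; elim/quotW=> v; elim/quotW=> w; rewrite !piE.
by apply/stalk_eqP/hfrac_cross => /=; ring.
Qed.

Lemma stalk_addC : commutative stalk_add.
Proof.
elim/quotW=> u; elim/quotW=> v; rewrite !piE.
by apply/stalk_eqP/hfrac_cross => /=; ring.
Qed.

Lemma stalk_add0 : left_id stalk_zero stalk_add.
Proof.
elim/quotW=> u; rewrite /stalk_zero !piE.
by apply/stalk_eqP/hfrac_cross => /=; ring.
Qed.

Lemma stalk_addN : left_inverse stalk_zero stalk_opp stalk_add.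
Proof.
elim/quotW=> u; rewrite /stalk_zero !piE.
by apply/stalk_eqP/hfrac_cross => /=; ring.
Qed.

HB.instance Definition _ :=
  GRing.isZmodule.Build stalk stalk_addA stalk_addC stalk_add0 stalk_addN.

Lemma stalk_mulA : associative stalk_mul.
Proof.
elim/quotW=> u; elim/quotW=> v; elim/quotW=> w; rewrite !piE.
by apply/stalk_eqP/hfrac_cross => /=; ring.
Qed.

Lemma stalk_mulC : commutative stalk_mul.
Proof.
elim/quotW=> u; elim/quotW=> v; rewrite !piE.
by apply/stalk_eqP/hfrac_cross => /=; ring.
Qed.

Lemma stalk_mul1 : left_id stalk_one stalk_mul.
Proof.
elim/quotW=> u; rewrite /stalk_one !piE.
by apply/stalk_eqP/hfrac_cross => /=; ring.
Qed.

Lemma stalk_mulDl : left_distributive stalk_mul (+%R : stalk -> stalk -> stalk).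
Proof.
change (left_distributive stalk_mul stalk_add).
elim/quotW=> u; elim/quotW=> v; elim/quotW=> w; rewrite !piE.
by apply/stalk_eqP/hfrac_cross => /=; ring.
Qed.

HB.instance Definition _ :=
  GRing.Zmodule_isComPzRing.Build stalk
    stalk_mulA stalk_mulC stalk_mul1 stalk_mulDl.

Lemma stalk_scaleA a b (s : stalk) :
  stalk_scale a (stalk_scale b s) = stalk_scale (a * b) s.
Proof.
elim/quotW: s => u; rewrite !piE.
by apply/stalk_eqP/hfrac_cross; rewrite /= scalerA.
Qed.

Lemma stalk_scale1 : left_id 1 stalk_scale.
Proof.
elim/quotW=> u; rewrite !piE.
by apply/stalk_eqP/hfrac_cross; rewrite /= scale1r.
Qed.

Lemma stalk_scaleDr :
  right_distributive stalk_scale (+%R : stalk -> stalk -> stalk).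
Proof.
change (right_distributive stalk_scale stalk_add).
move=> a; elim/quotW=> u; elim/quotW=> v; rewrite !piE.
by apply/stalk_eqP/hfrac_cross; rewrite /= -!mul_mpolyC; ring.
Qed.

Lemma stalk_scaleDl (s : stalk) :
  {morph stalk_scale^~ s : a b / a + b >-> a + b}.
Proof.
change ({morph stalk_scale^~ s : a b / a + b >-> stalk_add a b}).
move=> a b; elim/quotW: s => u; rewrite !piE.
by apply/stalk_eqP/hfrac_cross; rewrite /= -!mul_mpolyC mpolyCD; ring.
Qed.

HB.instance Definition _ :=
  GRing.Zmodule_isLmodule.Build R stalk
    stalk_scaleA stalk_scale1 stalk_scaleDr stalk_scaleDl.

Lemma stalk_scaleAl a (s t : stalk) : a *: (s * t) = (a *: s) * t.
Proof.
change (stalk_scale a (stalk_mul s t) = stalk_mul (stalk_scale a s) t).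
elim/quotW: s => u; elim/quotW: t => v; rewrite !piE.
by apply/stalk_eqP/hfrac_cross; rewrite /= -!mul_mpolyC; ring.
Qed.

(* The germ at p of the fraction a / f *)
Definition germ (a f : S) (s : stalk) : Prop :=
  exists u : hfrac, [/\ hnum u = a, hden u = f & s = \pi_stalk u].

Lemma germ0 : germ 0 1 0.
Proof. by exists hfrac0. Qed.

Lemma germ1 : germ 1 1 1.
Proof. by exists hfrac1. Qed.

Lemma germB a f s b g t :
  germ a f s -> germ b g t -> germ (a * g - b * f) (f * g) (s - t).
Proof.
move=> [u [<- <- ->]] [v [<- <- ->]]; exists (hadd u (hopp v)).
split=> //=; first by rewrite mulNr.
by rewrite pi_stalk_add pi_stalk_opp.
Qed.

Lemma germM a f s b g t :
  germ a f s -> germ b g t -> germ (a * b) (f * g) (s * t).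
Proof.
move=> [u [<- <- ->]] [v [<- <- ->]]; exists (hmul u v).
by split=> //=; rewrite pi_stalk_mul.
Qed.

Lemma germZ c a f s : germ a f s -> germ (c *: a) f (c *: s).
Proof.
move=> [u [<- <- ->]]; exists (hscale c u).
by split=> //=; rewrite pi_stalk_scale.
Qed.

End Stalk.

Definition stalk_family := forall p : point, stalk p.
HB.instance Definition _ := Choice.on stalk_family.

Implicit Types s t : stalk_family.

Definition family_zero : stalk_family := fun p => 0.
Definition family_one : stalk_family := fun p => 1.
Definition family_add s t : stalk_family := fun p => s p + t p.
Definition family_opp s : stalk_family := fun p => - s p.
Definition family_mul s t : stalk_family := fun p => s p * t p.
Definition family_scale (c : R) s : stalk_family := fun p => c *: s p.

Fact family_addA : associative family_add.
Proof. by move=> s t r; apply: functional_extensionality_dep => p; apply: addrA. Qed.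
Fact family_addC : commutative family_add.
Proof. by move=> s t; apply: functional_extensionality_dep => p; apply: addrC. Qed.
Fact family_add0 : left_id family_zero family_add.
Proof. by move=> s; apply: functional_extensionality_dep => p; apply: add0r. Qed.
Fact family_addN : left_inverse family_zero family_opp family_add.
Proof. by move=> s; apply: functional_extensionality_dep => p; apply: addNr. Qed.
HB.instance Definition _ := GRing.isZmodule.Build stalk_family
  family_addA family_addC family_add0 family_addN.

Fact family_mulA : associative family_mul.
Proof. by move=> s t r; apply: functional_extensionality_dep => p; apply: mulrA. Qed.
Fact family_mulC : commutative family_mul.
Proof. by move=> s t; apply: functional_extensionality_dep => p; apply: mulrC. Qed.
Fact family_mul1 : left_id family_one family_mul.
Proof. by move=> s; apply: functional_extensionality_dep => p; apply: mul1r. Qed.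
Fact family_mulDl : left_distributive family_mul +%R.
Proof. by move=> s t r; apply: functional_extensionality_dep => p; apply: mulrDl. Qed.
HB.instance Definition _ := GRing.Zmodule_isComPzRing.Build stalk_family
  family_mulA family_mulC family_mul1 family_mulDl.

Fact family_scaleA a b s :
  family_scale a (family_scale b s) = family_scale (a * b) s.
Proof. by apply: functional_extensionality_dep => p; apply: scalerA. Qed.
Fact family_scale1 : left_id 1 family_scale.
Proof. by move=> s; apply: functional_extensionality_dep => p; apply: scale1r. Qed.
Fact family_scaleDr : right_distributive family_scale +%R.
Proof. by move=> a s t; apply: functional_extensionality_dep => p; apply: scalerDr. Qed.
Fact family_scaleDl s : {morph family_scale^~ s : a b / a + b}.
Proof. by move=> a b; apply: functional_extensionality_dep => p; apply: scalerDl. Qed.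
HB.instance Definition _ := GRing.Zmodule_isLmodule.Build R stalk_family
  family_scaleA family_scale1 family_scaleDr family_scaleDl.

Definition locally_fraction : {pred stalk_family} := fun s =>
  `[< forall p : point, exists U : point -> Prop, exists a f : S,
      [/\ zariski_open U, U p & forall q : point, U q -> germ a f (s q)] >].

Lemma locally_fractionP s :
  reflect (forall p : point, exists U : point -> Prop, exists a f : S,
      [/\ zariski_open U, U p & forall q : point, U q -> germ a f (s q)])
    (s \in locally_fraction).
Proof. exact: asboolP. Qed.

Lemma zariski_openT : zariski_open (fun=> True).
Proof. by exists (fun a => a = 1) => p; split=> // _ /(_ _ erefl) /pt1. Qed.

Lemma zariski_openI U V :
  zariski_open U -> zariski_open V -> zariski_open (fun p => U p /\ V p).
Proof.
move=> [E UE] [D VD].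
exists (fun c => exists a b, [/\ E a, D b & c = a * b]) => p.
rewrite UE VD; split=> [[nE nD] ED|nED].
  apply: nE => a Ea; apply: contrapT => npa; apply: nD => b Db.
  by case: (pt_prime (ED _ (ex_intro _ a (ex_intro _ b (And3 Ea Db erefl))))).
split=> [Ep|Dp]; apply: nED => c [a [b [Ea Db ->]]].
  by rewrite mulrC; apply/ptM/Ep.
by apply/ptM/Dp.
Qed.

Fact locally_fraction_subring : subring_closed locally_fraction.
Proof.
split=> [|s t|s t].
- apply/locally_fractionP => p; exists (fun=> True), 1, 1.
  by split=> [||q _]; [exact: zariski_openT| |exact: germ1].
- move=> /locally_fractionP Hs /locally_fractionP Ht.
  apply/locally_fractionP => p.
  have [U [a [f [oU Up Us]]]] := Hs p; have [V [b [g [oV Vp Vt]]]] := Ht p.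
  exists (fun q => U q /\ V q), (a * g - b * f), (f * g).
  split=> [||q [Uq Vq]] //; first exact: zariski_openI.
  by apply: germB; [exact: Us|exact: Vt].
- move=> /locally_fractionP Hs /locally_fractionP Ht.
  apply/locally_fractionP => p.
  have [U [a [f [oU Up Us]]]] := Hs p; have [V [b [g [oV Vp Vt]]]] := Ht p.
  exists (fun q => U q /\ V q), (a * b), (f * g).
  split=> [||q [Uq Vq]] //; first exact: zariski_openI.
  by apply: germM; [exact: Us|exact: Vt].
Qed.

Fact locally_fraction_scale c :
  {homo *:%R c : s / s \in locally_fraction}.
Proof.
move=> s /locally_fractionP Hs; apply/locally_fractionP => p.
have [U [a [f [oU Up Us]]]] := Hs p; exists U, (c *: a), f.
by split=> // q Uq; apply: germZ; apply: Us.
Qed.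

HB.instance Definition _ :=
  GRing.isSubringClosed.Build stalk_family locally_fraction
    locally_fraction_subring.
HB.instance Definition _ :=
  GRing.isScaleClosed.Build R stalk_family locally_fraction
    locally_fraction_scale.

(* Gamma(T, O_T) *)
Record global_sections := GlobalSection {
  section_val : stalk_family;
  section_valP : section_val \in locally_fraction
}.

HB.instance Definition _ := [isSub for section_val].
HB.instance Definition _ := [Choice of global_sections by <:].
HB.instance Definition _ := GRing.SubChoice_isSubComPzRing.Build
  stalk_family locally_fraction global_sections locally_fraction_subring.
HB.instance Definition _ := [SubZmodule_isSubLmodule of global_sections by <:].

(* With this compatibility the ring and R-module structures make up an
   R-algebra. Algebra structures of the library exclude the zero ring, and
   global_sections is the zero ring when T is empty; this is why there is no
   comAlgType instance at this level of generality. *)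
Lemma global_sections_scaleAl (c : R) (s t : global_sections) :
  c *: (s * t) = (c *: s) * t.
Proof.
apply: val_inj; apply: functional_extensionality_dep => p.
exact: stalk_scaleAl.
Qed.

End ClosedSubscheme.

(* Indices run from 0, and the index set of the indeterminates u_ijk, namely
   'I_2 * 'I_n * 'I_n, is numbered by enum_rank. *)
Notation Lambda n := {mpoly int[#|{: 'I_2 * 'I_n * 'I_n}|]}.

Section UniversalTensor.
Variable n : nat.
Local Notation Lambda := (Lambda n).

Definition uvar (i : 'I_2) (j k : 'I_n) : Lambda := 'X_(enum_rank (i, j, k)).

Definition Cmx (i : 'I_2) : 'M[Lambda]_n := \matrix_(j, k) uvar i j k.

Definition Cx : 'M[{mpoly Lambda[2]}]_n :=
  \sum_(i < 2) 'X_i *: map_mx (@mpolyC 2 Lambda) (Cmx i).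

Definition Cy : 'M[{mpoly Lambda[n]}]_(2, n) :=
  \matrix_(i, k) \sum_(j < n) uvar i j k *: 'X_j.

Definition cdet : {mpoly Lambda[2]} := \det Cx.

Definition minors2 : seq {mpoly Lambda[n]} :=
  [seq Cy 0 kl.1 * Cy 1 kl.2 - Cy 0 kl.2 * Cy 1 kl.1
     | kl : 'I_n * 'I_n <- enum {: 'I_n * 'I_n} & (kl.1 < kl.2)%N].

(* sections_TCx is the ring R_c. *)
Definition sections_TCx := global_sections [:: cdet].
Definition sections_TCy := global_sections minors2.

End UniversalTensor.

(* Main.v *)
(* Let Q be the function field of the incidence variety y C(x) = 0 in
   P^1 x P^(n-1) over Lambda. It maps to both schemes, and both rings of sections
   embed in Q as the subrings of the elements that are regular on every chart,
   that is, polynomial in the coordinates x_l / x_i for every i, respectively in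
   the y_l / y_j for every j. These subrings coincide.

   On the chart y_j = 1, let L i k be the linear forms in C(y), so that
   L 0 k = - t L 1 k with t = x_1 / x_0. An element that is polynomial in t and
   in 1 / t is a combination of monomials in t and the L 1 k whose degree in t
   is at most their degree in the L 1 k; such a monomial is a product of forms
   L i k, and straightening by the minors makes it well defined.

   On the chart x_i = 1, M = C(x) is a generic matrix, and Cramer's rule
   for the Krylov matrix (e_0, M e_0, M^2 e_0, ...) gives y_j / y_0 with
   denominator d1 = kdet M. Reversing the order of the basis gives y_j / y_n
   with denominator d2. Since d1 and d2 do not change when M is replaced by
   M + X, whose determinant is monic in X, the quotient by det M is free over a
   ring in which d1, d2 is a regular sequence; so an element with denominators
   both a power of d1 and a power of d2 has no denominator. *)

From HB Require Import structures.
Require Import Defs.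
From mathcomp Require Import all_boot all_order all_algebra.
From mathcomp Require Import perm zify ring boolp.
From mathcomp Require Import ssrcomplements mpoly.
From mathcomp Require classical_sets.

Set Implicit Arguments.
Unset Strict Implicit.
Unset Printing Implicit Defensive.

Import GRing.Theory.

Local Open Scope ring_scope.
Local Open Scope quotient_scope.

Local Notation "x %:F" := (tofrac x).

(** * Values of polynomials *)

Lemma tofrac_inj (R : idomainType) : injective (@tofrac R).
Proof. by move=> a b /eqP; rewrite tofrac_eq => /eqP. Qed.

Section Evaluation.
Variables (n m : nat) (T : comNzRingType).
Variables (u : 'I_2 -> 'I_n -> 'I_n -> T) (x : 'I_m -> T).

Definition evL : Lambda n -> T :=
  mmap intr (fun t => let: (i, j, k) := enum_val t in u i j k).
HB.instance Definition _ := GRing.RMorphism.on evL.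

Definition ev : {mpoly (Lambda n)[m]} -> T := mmap evL x.
HB.instance Definition _ := GRing.RMorphism.on ev.

Lemma evL_uvar i j k : evL (uvar i j k) = u i j k.
Proof. by rewrite /evL /uvar mmapX mmap1U enum_rankK. Qed.

Lemma evC a : ev a%:MP = evL a. Proof. exact: mmapC. Qed.
Lemma evX l : ev 'X_l = x l. Proof. by rewrite /ev mmapX mmap1U. Qed.
Lemma ev_uvar i j k : ev (uvar i j k)%:MP = u i j k.
Proof. by rewrite evC evL_uvar. Qed.

Lemma evZ a p : ev (a *: p) = evL a * ev p.
Proof. by rewrite -mul_mpolyC rmorphM /= evC. Qed.

End Evaluation.

(* Parametricity: polynomials preserve every relation between two rings that is
   compatible with the ring operations. All the comparisons of values of a
   polynomial at two points below are instances. *)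
Section Parametricity.
Variables (T T' : comNzRingType) (rel : T -> T' -> Prop).
Hypotheses (rel1 : rel 1 1) (relN : forall a a', rel a a' -> rel (- a) (- a')).
Hypothesis relD : forall a a' b b',
  rel a a' -> rel b b' -> rel (a + b) (a' + b').
Hypothesis relM : forall a a' b b',
  rel a a' -> rel b b' -> rel (a * b) (a' * b').

Let rel0 : rel 0 0.
Proof. by rewrite -[X in rel X _](subrr 1) -[X in rel _ X](subrr 1); apply/relD/relN. Qed.

Let relX a a' k : rel a a' -> rel (a ^+ k) (a' ^+ k).
Proof. by move=> h; elim: k => [|k IH] //; rewrite !exprS; apply: relM. Qed.

Lemma mmap_rel (R : nzRingType) (m : nat) (f : {rmorphism R -> T})
  (f' : {rmorphism R -> T'}) (x : 'I_m -> T) (x' : 'I_m -> T') :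
  (forall a, rel (f a) (f' a)) -> (forall l, rel (x l) (x' l)) ->
  forall p, rel (mmap f x p) (mmap f' x' p).
Proof.
move=> hf hx; elim/mpolyind => [|c t p _ _ IH]; first by rewrite !mmap0.
rewrite !mmapD !mmapZ !mmapX; apply: (relD _ IH); apply: relM => //.
apply: (big_ind2 rel) => // i _.
exact: relX.
Qed.

Lemma ev_rel (n m : nat) (u : 'I_2 -> 'I_n -> 'I_n -> T)
  (u' : 'I_2 -> 'I_n -> 'I_n -> T') (x : 'I_m -> T) (x' : 'I_m -> T') :
  (forall i j k, rel (u i j k) (u' i j k)) -> (forall l, rel (x l) (x' l)) ->
  forall p, rel (ev u x p) (ev u' x' p).
Proof.
move=> hu hx; apply: mmap_rel => // a; apply: mmap_rel => [z|t]; last first.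
  by case: (enum_val t) => [[i j] k].
elim/int_rec: z => [|z IH|z IH]; first by rewrite !rmorph0.
  by rewrite intS !rmorphD; apply: relD => //; rewrite !rmorph1.
by rewrite intS opprD !rmorphD; apply: relD => //; rewrite !rmorphN1; apply: relN.
Qed.

End Parametricity.

Lemma mmap_pred (R : nzRingType) (T : comNzRingType) (P : T -> Prop) (m : nat)
  (f : {rmorphism R -> T}) (x : 'I_m -> T) :
  P 1 -> (forall a, P a -> P (- a)) ->
  (forall a b, P a -> P b -> P (a + b)) ->
  (forall a b, P a -> P b -> P (a * b)) ->
  (forall a, P (f a)) -> (forall l, P (x l)) ->
  forall p, P (mmap f x p).
Proof.
move=> P1 PN PD PM Pf Px p.
by apply: (@mmap_rel T T (fun a _ => P a) P1 _ _ _ R m f f x x) =>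
  // [a _|a _ b _|a _ b _]; [exact: PN|exact: PD|exact: PM].
Qed.

Lemma rmorph_mmap (R : nzRingType) (T T' : comNzRingType)
  (g : {rmorphism T -> T'}) (m : nat) (f : {rmorphism R -> T})
  (f' : {rmorphism R -> T'}) (x : 'I_m -> T) (x' : 'I_m -> T') p :
  (forall a, g (f a) = f' a) -> (forall l, g (x l) = x' l) ->
  g (mmap f x p) = mmap f' x' p.
Proof.
move=> gf gx; apply: (@mmap_rel _ _ (fun a b => g a = b)) => //.
- exact: rmorph1.
- by move=> a _ <-; rewrite rmorphN.
- by move=> a _ b _ <- <-; rewrite rmorphD.
- by move=> a _ b _ <- <-; rewrite rmorphM.
Qed.

Lemma mmap_id (R : comNzRingType) (m : nat) (p : {mpoly R[m]}) :
  mmap (@mpolyC m R) (fun l => 'X_l) p = p.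
Proof.
elim/mpolyind: p => [|c t p _ _ IH]; first by rewrite mmap0.
rewrite mmapD IH mmapZ mmapX -[in RHS]mul_mpolyC; congr (_ * _ + _).
by rewrite [RHS]mpolyXE_id.
Qed.

Lemma mmap_homog (R : nzRingType) (T : comNzRingType) (m d : nat)
  (f : {rmorphism R -> T}) (x x' : 'I_m -> T) z p :
  (forall l, x' l = z * x l) ->
  p \is d.-homog -> mmap f x' p = z ^+ d * mmap f x p.
Proof.
move=> xE /dhomogP hp; rewrite /mmap mulr_sumr; apply: eq_big_seq => t /hp /= <-.
rewrite mulrCA; congr (_ * _); rewrite /mmap1 mdegE -prodrXr -big_split /=.
by apply: eq_bigr => i _; rewrite xE exprMn.
Qed.

Lemma ev_pred (T : comNzRingType) (P : T -> Prop) (n m : nat)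
  (u : 'I_2 -> 'I_n -> 'I_n -> T) (x : 'I_m -> T) :
  P 1 -> (forall a, P a -> P (- a)) ->
  (forall a b, P a -> P b -> P (a + b)) ->
  (forall a b, P a -> P b -> P (a * b)) ->
  (forall i j k, P (u i j k)) -> (forall l, P (x l)) ->
  forall p, P (ev u x p).
Proof.
move=> P1 PN PD PM Pu Px p.
by apply: (@ev_rel T T (fun a _ => P a) P1 _ _ _ n m u u x x) => // [a _|a _ b _|a _ b _];
  [exact: PN|exact: PD|exact: PM].
Qed.

Lemma rmorph_ev (T T' : comNzRingType) (f : {rmorphism T -> T'}) (n m : nat)
  (u : 'I_2 -> 'I_n -> 'I_n -> T) (x : 'I_m -> T) p :
  f (ev u x p) = ev (fun i j k => f (u i j k)) (fun l => f (x l)) p.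
Proof.
pattern (ev u x p), (ev (fun i j k => f (u i j k)) (fun l => f (x l)) p).
set P := (fun _ => _).
apply: (@ev_rel _ _ P) => //; rewrite /P.
- exact: rmorph1.
- by move=> a _ <-; rewrite rmorphN.
- by move=> a _ b _ <- <-; rewrite rmorphD.
- by move=> a _ b _ <- <-; rewrite rmorphM.
Qed.

Lemma rmorph_evL (T T' : comNzRingType) (f : {rmorphism T -> T'}) n
  (u : 'I_2 -> 'I_n -> 'I_n -> T) u' a :
  (forall i j k, f (u i j k) = u' i j k) -> f (evL u a) = evL u' a.
Proof.
move=> fu; apply: rmorph_mmap => [z|t]; first exact: rmorph_int.
by case: (enum_val t) => [[i j] k].
Qed.

Lemma eq_ev (T : comNzRingType) (n m : nat)
  (u u' : 'I_2 -> 'I_n -> 'I_n -> T) (x x' : 'I_m -> T) p :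
  (forall i j k, u i j k = u' i j k) -> x =1 x' -> ev u x p = ev u' x' p.
Proof.
move=> hu hx; apply: (@ev_rel _ _ (fun a b => a = b)) => //.
- by move=> a _ <-.
- by move=> a _ b _ <- <-.
- by move=> a _ b _ <- <-.
Qed.

Lemma evL_id (n : nat) (a : Lambda n) : evL (@uvar n) a = a.
Proof.
rewrite -[RHS]mmap_id; apply: (@mmap_rel _ _ eq) => //.
- by move=> b _ <-.
- by move=> b _ c _ <- <-.
- by move=> b _ c _ <- <-.
- by move=> z; rewrite -[in RHS](intz z) rmorph_int.
by move=> t; rewrite -[in RHS](enum_valK t); case: (enum_val t) => [[i j] k].
Qed.

(** * Primes and their homogeneous cores *)

Section Ideals.
Variable S : comNzRingType.

Definition ideal (I : S -> Prop) :=
  [/\ I 0, forall a b, I a -> I b -> I (a + b) & forall a b, I b -> I (a * b)].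

Definition prime_ideal (P : S -> Prop) :=
  [/\ ideal P, ~ P 1 & forall a b, P (a * b) -> P a \/ P b].

Lemma prime_ideal_above (I : S -> Prop) :
  ideal I -> ~ I 1 -> exists2 P, prime_ideal P & forall a, I a -> P a.
Proof.
move=> idI nI1.
pose good (A : S -> Prop) := [/\ ideal A, ~ A 1 & forall a, I a -> A a].
(* Goodness is asked of nonempty sets only, because the empty chain has the empty union. The maximal
   set is nonempty all the same, since otherwise [I] would be larger. *)
have [A [PA maxA]] : exists A : S -> Prop, ((exists a, A a) -> good A) /\
    forall B : S -> Prop, (forall a, A a -> B a) -> ~ (forall a, B a -> A a) ->
      ~ ((exists a, B a) -> good B).
  have [|A [PA maxA]] :=
      @classical_sets.Zorn_bigcup S (fun A => (exists a, A a) -> good A).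
    move=> F FP Ftot [a0 [A0 FA0 A0a0]].
    have gF A a : F A -> A a -> good A by move=> FA Aa; apply: FP FA _; exists a.
    have [_ _ IA0] := gF _ _ FA0 A0a0.
    split.
    - split.
      + by exists A0 => //; case: (gF _ _ FA0 A0a0) => [[]].
      + move=> a b [A FA Aa] [B FB Bb].
        have [[_ AD _] _ _] := gF _ _ FA Aa; have [[_ BD _] _ _] := gF _ _ FB Bb.
        by have [AB|BA] := Ftot _ _ FA FB; [exists B|exists A] => //=;
          [apply: BD (AB _ Aa) Bb|apply: AD Aa (BA _ Bb)].
      + move=> a b [A FA Ab]; exists A => //.
        by have [[_ _ AM] _ _] := gF _ _ FA Ab; apply: AM.
    - by move=> [A FA A1]; have [_ + _] := gF _ _ FA A1; apply.
    - by move=> a /IA0 A0a; exists A0.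
  exists A; split=> // B AB nBA; apply: maxA.
  by split.
have {PA}[idA nA1 IA] : good A.
  apply: PA; apply: contrapT => nA.
  apply: (maxA I) => [a Aa|IA|_]; [by case: nA; exists a| |by split].
  by apply: nA; exists 0; apply: IA; case: idI.
exists A => //; split=> // a b Aab.
have [A0 AD AM] := idA.
have [Aa|nAa] := pselect (A a); first by left.
(* [B] is the ideal generated by [A] and [a]. By maximality it contains 1, and multiplying 1 = d + e
   a by [b] puts [b] in [A]. *)
right; pose B c := exists d e, A d /\ c = d + e * a.
have B1 : B 1.
  apply: contrapT => nB1; apply: (maxA B) => [c Ac|BA|_].
  - by exists c, 0; rewrite mul0r addr0.
  - by apply/nAa/BA; exists 0, 1; rewrite mul1r add0r.
  - split=> //.
      split; first by exists 0, 0; rewrite mul0r addr0.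
        move=> c d [c1 [c2 [Ac ->]]] [d1 [d2 [Ad ->]]].
        by exists (c1 + d1), (c2 + d2); split; [exact: AD|ring].
      move=> c d [d1 [d2 [Ad ->]]].
      by exists (c * d1), (c * d2); split; [exact: AM|ring].
    by move=> c /IA Ac; exists c, 0; rewrite mul0r addr0.
have [d [e [Ad e1]]] := B1.
have -> : b = b * d + e * (a * b) by rewrite -[LHS]mulr1 e1; ring.
by apply: AD; apply: AM.
Qed.

Lemma sum_ideal (I : S -> Prop) (K : Type) (r : seq K) (Q : pred K) (f : K -> S) :
  ideal I -> (forall i, Q i -> I (f i)) -> I (\sum_(i <- r | Q i) f i).
Proof. by move=> [I0 ID _] If; apply: big_ind. Qed.

End Ideals.

Section HomogeneousCore.
Variables (R : comNzRingType) (m : nat).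
Local Notation S := {mpoly R[m]}.
Local Notation pi d a := (pihomog mdeg d a).

Lemma pihomogM d (a b : S) :
  pi d (a * b) = \sum_(e < d.+1) pi e a * pi (d - e) b.
Proof.
pose k := maxn d.+1 (maxn (msize a) (msize b)).
have dk : (d < k)%N by rewrite leq_maxl.
have Ea : a = \sum_(i < k) pi i a.
  by apply: pihomog_partitionE; rewrite /k !leq_max leqnn !orbT.
have Eb : b = \sum_(i < k) pi i b.
  by apply: pihomog_partitionE; rewrite /k !leq_max leqnn !orbT.
rewrite {1}Ea {1}Eb mulr_suml linear_sum /=.
rewrite (big_ord_widen k (fun e => pi e a * pi (d - e) b)) //=.
rewrite [RHS]big_mkcond; apply: eq_bigr => i _.
rewrite mulr_sumr linear_sum /=; case: ltnP => [|di].
  rewrite ltnS => id; have dik : (d - i < k)%N by apply: leq_ltn_trans dk; rewrite leq_subr.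
  rewrite (bigD1 (Ordinal dik)) //= big1 ?addr0 => [|j nj].
    rewrite pihomog_dE //; have := dhomogM (pihomogP mdeg i a) (pihomogP mdeg (d - i) b).
    by rewrite subnKC.
  apply: (pihomog_ne0 _ (dhomogM (pihomogP mdeg i a) (pihomogP mdeg j b))).
  by apply: contra nj => /eqP E; rewrite -val_eqE /= -E addKn.
rewrite big1 // => j _.
apply: (pihomog_ne0 _ (dhomogM (pihomogP mdeg i a) (pihomogP mdeg j b))).
by rewrite gtn_eqF // ltn_addr.
Qed.

Variables (P : S -> Prop) (primeP : prime_ideal P).

(** The largest homogeneous ideal contained in [P]. *)
Definition homog_core (a : S) := forall d, P (pi d a).

Lemma homog_core_homog d a : a \is d.-homog -> homog_core a <-> P a.
Proof.
have [[P0 _ _] _ _] := primeP.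
move=> ad; split=> [/(_ d)|Pa e]; first by rewrite pihomog_dE.
by have [<-|ne] := eqVneq d e; [rewrite pihomog_dE|rewrite (pihomog_ne0 ne ad)].
Qed.

(** If neither factor is in the core, take their components of lowest degrees d and e outside [P].
    Modulo [P] the component of degree d + e of the product is the product of these two, which is
    not in [P]. *)
Lemma homog_core_prime a b :
  homog_core (a * b) -> homog_core a \/ homog_core b.
Proof.
have [idP _ pP] := primeP; have [P0 PD PM] := idP.
move=> Pab; have [Pa|nPa] := pselect (homog_core a); first by left.
right; apply: contrapT => nPb.
have least c : ~ homog_core c ->
    exists2 d, ~ P (pi d c) & forall e, (e < d)%N -> P (pi e c).
  move=> /existsNP[d0 nd0].
  have ex : exists d, ~~ `[< P (pi d c) >] by exists d0; apply/asboolP.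
  exists (ex_minn ex); case: ex_minnP => d /asboolP nd mind // e ed.
  apply: contrapT => nP.
  by have := mind e (introN (asboolP _) nP); rewrite leqNgt ed.
have [d nd mind] := least _ nPa; have [e ne mine] := least _ nPb.
have := Pab (d + e)%N; rewrite pihomogM.
have dde : (d < (d + e).+1)%N by rewrite ltnS leq_addr.
rewrite (bigD1 (Ordinal dde)) //= addKn => Psum.
have : P (pi d a * pi e b).
  set s := \sum_(_ < _ | _) _ in Psum.
  have Ps : P s.
    apply: sum_ideal => // i ni.
    have [id|di] := ltnP i d; first by rewrite mulrC; apply/PM/mind.
    have lt : (d + e - i < e)%N.
      have := ltn_ord i; move: ni; rewrite -val_eqE /= => /eqP; lia.
    by apply: PM; apply: mine.
  by rewrite -[X in P X](addrK s) addrC; apply: PD Psum; rewrite -mulN1r; apply: PM.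
by move=> /pP [].
Qed.

(** Turns an arbitrary prime, such as one coming from Zorn's lemma, into a point of the scheme with
    the same homogeneous elements. *)
Lemma homog_core_point (F : seq S) (i : 'I_m) :
  ~ P 'X_i -> (forall f, f \in F -> P f) ->
  (forall f, f \in F -> exists d, f \is d.-homog) ->
  exists p : point F, forall d a, a \is d.-homog -> p a <-> P a.
Proof.
have [[P0 PD PM] _ _] := primeP.
move=> nXi PF hF.
have c0 : homog_core 0 by move=> d; rewrite pihomog0.
have cD a b : homog_core a -> homog_core b -> homog_core (a + b).
  by move=> ha hb d; rewrite pihomogD; apply: PD.
have cM a b : homog_core b -> homog_core (a * b).
  move=> hb d; rewrite pihomogM; apply: sum_ideal => [|j _]; first by split.
  exact/PM/hb.
have ch d a : homog_core a -> homog_core (pi d a).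
  by move=> ha; apply/(homog_core_homog (pihomogP mdeg d a)).
have cr : exists i, ~ homog_core 'X_i.
  have X1 : ('X_i : S) \is 1.-homog by rewrite dhomogX; apply/eqP/mdeg1.
  by exists i => /(homog_core_homog X1).
have cF f : f \in F -> homog_core f.
  by move=> fF; have [d fd] := hF _ fF; apply/(homog_core_homog fd)/PF.
exists (Point c0 cD cM homog_core_prime ch cr cF) => d a.
exact: homog_core_homog.
Qed.

End HomogeneousCore.

(** * Sections as functions at a generic point *)

Lemma ideal_gen_mem (R : comNzRingType) m (F : seq {mpoly R[m]}) f :
  f \in F -> ideal_gen F f.
Proof.
move=> fF; have lt : (index f F < size F)%N by rewrite index_mem.
exists (fun l => (l == Ordinal lt)%:R).
rewrite (bigD1 (Ordinal lt)) //= eqxx mul1r nth_index // big1 ?addr0 //.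
by move=> l /negPf ->; rewrite mul0r.
Qed.

Lemma mpolyX_homog (R : nzRingType) m (i : 'I_m) : ('X_i : {mpoly R[m]}) \is 1.-homog.
Proof. by rewrite dhomogX; apply/eqP/mdeg1. Qed.

Lemma mpolyXn_homog (R : nzRingType) m (i : 'I_m) N :
  ('X_i ^+ N : {mpoly R[m]}) \is N.-homog.
Proof. by have := dhomogMn N (mpolyX_homog R i); rewrite mul1n. Qed.

Section GenericPoint.
Variables (R : idomainType) (m : nat).
Local Notation S := {mpoly R[m]}.
Variables (F : seq S).
Hypothesis F_homog : forall f, f \in F -> exists d, f \is d.-homog.

(** Substituting [X_l / X_i] for [X_l] kills [X_i - 1] and divides a homogeneous polynomial of
    degree e by [X_i ^ e]. Clearing the powers of [X_i] from the resulting identity leaves a member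
    of the ideal. *)
Lemma homogenize (i : 'I_m) d a b c :
  a \is d.-homog -> ideal_gen F b -> a = b + ('X_i - 1) * c ->
  exists N, ideal_gen F ('X_i ^+ N * a).
Proof.
move=> ad [q Eb] Ea.
have Xi0 : ('X_i : S)%:F != 0.
  by rewrite tofrac_eq0 -msize_poly_eq0 msizeX.
pose u : {rmorphism R -> {fraction S}} := @tofrac S \o @mpolyC m R.
pose x l : {fraction S} := ('X_l : S)%:F.
pose om : {rmorphism S -> {fraction S}} := mmap u (fun l => x l / x i).
have om_homog e (f : S) : f \is e.-homog -> f%:F = x i ^+ e * om f.
  move=> fe; rewrite -(@mmap_homog _ _ _ _ u _ x _ _ _ fe).
    by rewrite -[in LHS](mmap_id f); apply: rmorph_mmap.
  by move=> l; rewrite mulrCA divff ?mulr1.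
have om_den (f : S) : exists N g, x i ^+ N * om f = g%:F.
  apply: (@mmap_pred _ _ (fun w => exists N g, x i ^+ N * w = g%:F)).
  - by exists 0%N, 1; rewrite mulr1 tofrac1.
  - by move=> w [N [g E]]; exists N, (- g); rewrite mulrN E tofracN.
  - move=> w v [N [g E]] [N' [g' E']].
    exists (N + N')%N, ('X_i ^+ N' * g + 'X_i ^+ N * g').
    by rewrite tofracD !tofracM !tofracXn -E -E' exprD; ring.
  - move=> w v [N [g E]] [N' [g' E']].
    by exists (N + N')%N, (g * g'); rewrite tofracM -E -E' exprD; ring.
  - by move=> r; exists 0%N, r%:MP; rewrite mul1r.
  - by move=> l; exists 1%N, 'X_l; rewrite mulrCA divff ?mulr1.
(* [D] collects the fractions that some power of [X_i] carries into the ideal of [F]. *)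
pose D w := exists N r, ideal_gen F r /\ x i ^+ N * w = r%:F.
have [N [r [Fr E]]] : D (om a).
  rewrite Ea Eb.
  have om0 : om ('X_i - 1) = 0.
    by rewrite rmorphB rmorph1 /om /= mmapX mmap1U divff ?subrr.
  rewrite rmorphD [X in _ + X]rmorphM om0 mul0r addr0 rmorph_sum.
  elim/big_ind: _ => [|w v|k _].
  - by exists 0%N, 0; split; [exact: ideal_gen0|rewrite mulr0 tofrac0].
  - move=> [N [g [Fg E]]] [N' [g' [Fg' E']]].
    exists (N + N')%N, ('X_i ^+ N' * g + 'X_i ^+ N * g'); split.
      by apply: ideal_genD; apply: ideal_genM.
    by rewrite tofracD !tofracM !tofracXn -E -E' exprD; ring.
  - have [e Fe] := F_homog (mem_nth 0 (ltn_ord k)).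
    have [N [g E]] := om_den (q k).
    exists (e + N)%N, (g * F`_k); split.
      exact/ideal_genM/ideal_gen_mem/mem_nth.
    by rewrite rmorphM tofracM (om_homog _ _ Fe) -E exprD; ring.
exists N.
suff -> : 'X_i ^+ N * a = 'X_i ^+ d * r by apply: ideal_genM.
apply: tofrac_inj.
by rewrite !tofracM !tofracXn (om_homog _ _ ad) -E mulrCA.
Qed.

Variables (Q : fieldType) (U : {rmorphism R -> Q}) (X : 'I_m -> Q).
Hypotheses (X_neq0 : forall l, X l != 0) (i0 : 'I_m).
Hypothesis F_vanish : forall f, f \in F -> mmap U X f = 0.
Hypothesis F_ker : forall i p, mmap U (fun l => X l / X i) p = 0 ->
  exists b c, ideal_gen F b /\ p = b + ('X_i - 1) * c.

Local Notation th := (mmap U X).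
Local Notation thd i := (mmap U (fun l => X l / X i)).

Lemma ev_dehomog i d a : a \is d.-homog -> th a = X i ^+ d * thd i a.
Proof.
move=> ad; apply: mmap_homog ad => l.
by rewrite mulrCA divff ?mulr1.
Qed.

Lemma ev_rehomog i h :
  exists N a, a \is N.-homog /\ th a = X i ^+ N * thd i h.
Proof.
apply: (@mmap_pred _ _ (fun w => exists N a, a \is N.-homog /\ th a = X i ^+ N * w)).
- by exists 0%N, 1; split; [exact: dhomog1|rewrite rmorph1 mulr1].
- move=> w [N [a [aN E]]]; exists N, (- a).
  by split; [rewrite dhomogN|rewrite rmorphN /= E mulrN].
- move=> w v [N [a [aN E]]] [N' [a' [aN' E']]].
  exists (N + N')%N, ('X_i ^+ N' * a + 'X_i ^+ N * a'); split.
    by apply: rpredD; [rewrite addnC|]; apply: dhomogM => //; apply: mpolyXn_homog.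
  by rewrite rmorphD /= !rmorphM !rmorphXn /= mmapX mmap1U E E' exprD; ring.
- move=> w v [N [a [aN E]]] [N' [a' [aN' E']]].
  exists (N + N')%N, (a * a'); split; first exact: dhomogM.
  by rewrite rmorphM /= E E' exprD; ring.
- move=> r; exists 0%N, r%:MP; rewrite mmapC mul1r; split=> //.
  by rewrite -[_%:MP]mulr1 mul_mpolyC; apply/rpredZ/dhomog1.
- move=> l; exists 1%N, 'X_l; rewrite mmapX mmap1U expr1 mulrCA divff ?mulr1 //; split=> //.
  exact: mpolyX_homog.
Qed.

Lemma ev_ideal_gen a : ideal_gen F a -> th a = 0.
Proof.
move=> [q ->]; rewrite rmorph_sum big1 // => i _.
by rewrite rmorphM /= (F_vanish (mem_nth 0 (ltn_ord i))) mulr0.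
Qed.

(** By [F_ker] the chart ring S / (F, X_i - 1) embeds in [Q], so a vanishing value puts [a] in the
    ideal of the chart; homogenizing costs a power of [X_i]. *)
Lemma ev_eq0 i d a :
  a \is d.-homog -> th a = 0 -> exists N, ideal_gen F ('X_i ^+ N * a).
Proof.
move=> ad; rewrite (ev_dehomog i ad) => /eqP.
rewrite mulf_eq0 expf_eq0 (negPf (X_neq0 i)) andbF /= => /eqP /F_ker [b [c [Fb E]]].
exact: homogenize ad Fb E.
Qed.

Lemma point_ideal_gen (p : point F) a : ideal_gen F a -> p a.
Proof.
move=> [q ->]; elim/big_ind: _ => [|a' b' pa pb|i _]; first exact: pt0.
  exact: ptD.
by apply/ptM/pt_sub/mem_nth.
Qed.

(** A power of a coordinate outside [p] multiplies [a] into the ideal of [F], hence into [p], and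
    [p] is prime. *)
Lemma point_ev (p : point F) d a : a \is d.-homog -> th a = 0 -> p a.
Proof.
move=> ad /(ev_eq0 _ ad); have [i nXi] := pt_relevant p => /(_ i) [N].
move=> /(point_ideal_gen p); elim: N => [|N IH]; first by rewrite mul1r.
by rewrite exprS -mulrA => /pt_prime [].
Qed.

Lemma XnP (p : point F) i N : ~ p 'X_i -> ~ p ('X_i ^+ N).
Proof. by move=> nXi; elim: N => [/pt1 //|N IH]; rewrite exprS => /pt_prime []. Qed.

Lemma ev_homog_neq0 (p : point F) a : a \is homog mdeg -> ~ p a -> th a != 0.
Proof. by move=> /homogP[d ad] npa; apply/eqP => /(point_ev p ad). Qed.

Definition hval (p : point F) (w : hfrac p) : Q := th (hnum w) / th (hden w).

Lemma hden_neq0 (p : point F) (w : hfrac p) : th (hden w) != 0.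
Proof.
apply: (ev_homog_neq0 (p := p)) (@hdenP _ _ _ _ w).
by apply/homogP; exists (hdeg w); apply: hden_homog.
Qed.

(** This embeds every stalk in [Q]. If the values agree, a power of a coordinate outside [p] is the
    multiplier that the equivalence of fractions requires; conversely such a multiplier has nonzero
    value and cancels. *)
Lemma hvalP (p : point F) (w v : hfrac p) :
  hval w = hval v <-> \pi_(stalk p) w = \pi_(stalk p) v.
Proof.
have EQ : hval w = hval v <-> th (hnum w * hden v - hnum v * hden w) = 0.
  rewrite /hval rmorphB !rmorphM /=.
  have w0 := hden_neq0 w; have v0 := hden_neq0 v.
  split=> [/eqP|/eqP]; last by rewrite subr_eq0 => /eqP E; apply/eqP; rewrite eqr_div // E.
  by rewrite eqr_div // => /eqP ->; rewrite subrr.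
rewrite EQ; split=> [E|/stalk_eqP/hfrac_equivP[h [hh nph /ev_ideal_gen]]].
  apply/stalk_eqP/hfrac_equivP; have [i nXi] := pt_relevant p.
  have hom : hnum w * hden v - hnum v * hden w \is (hdeg w + hdeg v).-homog.
    apply: rpredB; last rewrite addnC; apply: dhomogM;
      by [apply: hnum_homog | apply: hden_homog].
  have [N FN] := ev_eq0 i hom E; exists ('X_i ^+ N); split=> //; last exact: XnP.
  by apply/homogP; exists N; apply: mpolyXn_homog.
by move=> /eqP; rewrite rmorphM mulf_eq0 (negPf (ev_homog_neq0 hh nph)) => /eqP.
Qed.

Definition stalk_val (p : point F) (s : stalk p) : Q := hval (repr s).

Lemma stalk_val_pi (p : point F) (w : hfrac p) :
  stalk_val (\pi_(stalk p) w) = hval w.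
Proof. by apply/hvalP; rewrite reprK. Qed.

Lemma stalk_val_inj (p : point F) : injective (@stalk_val p).
Proof.
elim/quotW=> w; elim/quotW=> v; rewrite !stalk_val_pi.
by move=> /hvalP.
Qed.

Lemma stalk_val1 (p : point F) : stalk_val (1 : stalk p) = 1.
Proof.
have -> : (1 : stalk p) = \pi_(stalk p) (hfrac1 p) by [].
by rewrite stalk_val_pi /hval /= rmorph1 divr1.
Qed.

Lemma stalk_valD (p : point F) (s t : stalk p) :
  stalk_val (s + t) = stalk_val s + stalk_val t.
Proof.
elim/quotW: s => w; elim/quotW: t => v.
have -> : \pi_(stalk p) w + \pi_(stalk p) v = \pi_(stalk p) (hadd w v).
  by rewrite pi_stalk_add.
rewrite !stalk_val_pi /hval /= rmorphD !rmorphM /=.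
by rewrite addf_div ?hden_neq0.
Qed.

Lemma stalk_valM (p : point F) (s t : stalk p) :
  stalk_val (s * t) = stalk_val s * stalk_val t.
Proof.
elim/quotW: s => w; elim/quotW: t => v.
have -> : \pi_(stalk p) w * \pi_(stalk p) v = \pi_(stalk p) (hmul w v).
  by rewrite pi_stalk_mul.
by rewrite !stalk_val_pi /hval /= !rmorphM /= mulf_div.
Qed.

Lemma stalk_valZ (p : point F) c (s : stalk p) :
  stalk_val (c *: s) = U c * stalk_val s.
Proof.
elim/quotW: s => w.
have -> : c *: \pi_(stalk p) w = \pi_(stalk p) (hscale c w).
  by rewrite pi_stalk_scale.
by rewrite !stalk_val_pi /hval /= mmapZ mulrA.
Qed.

Lemma stalk_val_germ (p : point F) a f s :
  @germ _ _ _ p a f s -> stalk_val s = th a / th f.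
Proof. by move=> [w [<- <- ->]]; rewrite stalk_val_pi. Qed.

(** The kernel of the evaluation in the field [Q] is prime; its homogeneous core is the generic
    point. *)
Lemma generic_point :
  exists p : point F, forall d a, a \is d.-homog -> p a <-> th a = 0.
Proof.
apply: (@homog_core_point _ _ (fun a => th a = 0) _ _ i0) F_vanish F_homog.
- split=> [|/eqP|a b /eqP]; last 2 first.
  + by rewrite rmorph1 oner_eq0.
  + by rewrite rmorphM mulf_eq0 => /orP[] /eqP; [left|right].
  split=> [|a b a0 b0|a b b0]; first exact: rmorph0.
    by rewrite rmorphD /= a0 b0 addr0.
  by rewrite rmorphM /= b0 mulr0.
- by rewrite mmapX mmap1U; apply/eqP.
Qed.

(** The generic point is the smallest point, so it lies in every nonempty open set. *)
Lemma point_generic (p0 p : point F) a :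
  (forall d b, b \is d.-homog -> p0 b <-> th b = 0) -> p0 a -> p a.
Proof.
move=> p0E p0a; rewrite [a](@pihomog_partitionE _ _ mdeg (msize a)) //.
elim/big_ind: _ => [|b c|d _]; [exact: pt0|exact: ptD|].
apply: (point_ev p (pihomogP mdeg d a)).
by apply/(p0E _ _ (pihomogP mdeg d a)); apply: pt_homog.
Qed.

Lemma hfrac_exists (p : point F) v : (forall i, exists h, v = thd i h) ->
  exists i N a, [/\ ~ p 'X_i, a \is N.-homog & th a = X i ^+ N * v].
Proof.
move=> hv; have [i nXi] := pt_relevant p; have [h ->] := hv i.
by have [N [a [aN E]]] := ev_rehomog i h; exists i, N, a.
Qed.

Theorem global_sections_field : exists g : global_sections F -> Q,
  [/\ injective g, g 1 = 1 /\ {morph g : s t / s + t}, {morph g : s t / s * t},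
      forall c s, g (c *: s) = U c * g s
    & forall v, (exists s, g s = v) <-> forall i, exists h, v = thd i h].
Proof.
have [p0 p0E] := generic_point.
pose g (s : global_sections F) := stalk_val (section_val s p0).
(* The neighbourhood of [p] on which [s] is a single fraction also contains [p0], so the germs at
   both points have the same value. *)
have gE s p : stalk_val (section_val s p) = g s.
  have /locally_fractionP/(_ p)[V [a [f [[E VE] Vp Vs]]]] := section_valP s.
  have Vp0 : V p0.
    apply/VE => Ep0; move/VE: Vp; apply=> b /Ep0.
    exact: point_generic.
  by rewrite /g (stalk_val_germ (Vs _ Vp)) (stalk_val_germ (Vs _ Vp0)).
exists g; split.
- move=> s t st; apply: val_inj; apply: functional_extensionality_dep => p.
  by apply: stalk_val_inj; rewrite !gE.
- by split=> [|s t]; [exact: stalk_val1|exact: stalk_valD].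
- by move=> s t; apply: stalk_valM.
- by move=> c s; apply: stalk_valZ.
move=> v; split=> [[s <-] i|hv]; last first.
  (* The converse inclusion: where [X_i] does not vanish, [v] is the fraction [a / X_i ^ N], and
     these fractions glue because the stalks embed in [Q]. *)
  have ex (p : point F) : exists w : hfrac p, hval w = v.
    have [i [N [a [nXi aN E]]]] := hfrac_exists p hv.
    exists (HFrac aN (mpolyXn_homog _ i N) (XnP nXi)).
    by rewrite /hval /= E rmorphXn /= mmapX mmap1U mulrAC divff ?mul1r // expf_neq0.
  pose sec : stalk_family F := fun p => \pi_(stalk p) (projT1 (cid (ex p))).
  have secP : sec \in locally_fraction (F := F).
    apply/locally_fractionP => p.
    have [i [N [a [nXi aN E]]]] := hfrac_exists p hv.
    exists (fun q => ~ q 'X_i), a, ('X_i ^+ N); split=> // [|q nq].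
      exists (fun b => b = 'X_i) => q; split=> [nq /(_ _ erefl) //|nq qX].
      by apply: nq => _ ->.
    exists (HFrac aN (mpolyXn_homog _ i N) (XnP nq)); split=> //.
    apply/hvalP; case: (cid (ex q)) => /= w ->.
    by rewrite /hval /= E rmorphXn /= mmapX mmap1U mulrAC divff ?mul1r // expf_neq0.
  exists (GlobalSection secP); rewrite /g /= /sec.
  by rewrite stalk_val_pi; case: (cid (ex p0)).
(* [J] is the ideal of denominators of [g s] on the chart [X_i = 1]. If it were proper, a prime
   above it would give a point of the chart, and the denominator of the germ of [s] there would lie
   in [J] but outside that point. *)
pose J h := exists h', g s * thd i h = thd i h'.
have [[h]|nJ1] := pselect (J 1); first by rewrite rmorph1 mulr1 => E; exists h.
have [|P primeP JP] := prime_ideal_above _ nJ1.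
  split; first by exists 0; rewrite !rmorph0 mulr0.
    by move=> a b [a' E] [b' E']; exists (a' + b'); rewrite !rmorphD mulrDr E E'.
  by move=> a b [b' E]; exists (a * b'); rewrite !rmorphM mulrCA E.
have [[_ PD PM] nP1 _] := primeP.
have dX : thd i ('X_i - 1) = 0.
  by rewrite rmorphB rmorph1 /= mmapX mmap1U divff ?subrr.
have nXi : ~ P 'X_i.
  move=> PX; apply: nP1.
  have -> : 1 = 'X_i + -1 * ('X_i - 1) :> S by ring.
  by apply: PD => //; apply/PM/JP; exists 0; rewrite dX mulr0 rmorph0.
have FP f : f \in F -> P f.
  move=> fF; apply: JP; exists 0; rewrite rmorph0; have [d fd] := F_homog fF.
  have /eqP := F_vanish fF; rewrite (ev_dehomog i fd) mulf_eq0 expf_eq0.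
  by rewrite (negPf (X_neq0 i)) andbF => /eqP ->; rewrite mulr0.
have [p pE] := homog_core_point primeP nXi FP F_homog.
have := gE s p; elim/quotW: (section_val s p) => w; rewrite stalk_val_pi => gw.
case: (@hdenP _ _ _ _ w); apply/(pE _ _ (hden_homog w)); apply: JP.
exists (hnum w); rewrite -gw /hval.
have := hden_neq0 w.
rewrite (ev_dehomog i (hnum_homog w)) (ev_dehomog i (hden_homog w)).
rewrite mulf_eq0 negb_or => /andP[Xd0 d0].
by rewrite -mulf_div divff // mul1r divfK.
Qed.

End GenericPoint.

(** * Krylov determinants *)

Section Krylov.
Variables (R : comNzRingType) (n : nat).
Implicit Types M : 'M[R]_n.+1.

Definition krylov M : 'M[R]_n.+1 := \matrix_(j, k) (M ^+ k) j 0.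
Definition kdet M := \det (krylov M).
(** This row pairs to [kdet M] with the Krylov column e_0 and to 0 with the other ones. By Cramer's
    rule it is the candidate for a left kernel vector of [M]. *)
Definition kvec M : 'rV[R]_n.+1 := row 0 (\adj (krylov M)).

(** By the binomial theorem, adding a scalar changes the Krylov columns by a unitriangular
    matrix. *)
Lemma kdet_shift M s : kdet (M + s%:M) = kdet M.
Proof.
(* For k < l the exponent is truncated to 0, but there the binomial coefficient vanishes. *)
pose T : 'M[R]_n.+1 := \matrix_(l, k) (s ^+ (k - l) *+ 'C(k, l)).
have -> : kdet (M + s%:M) = \det (krylov M *m T).
  congr (\det _); apply/matrixP => j k; rewrite !mxE.
  rewrite addrC exprDn_comm; last exact: comm_scalar_mx.
  rewrite summxE.
  have kn : (k.+1 <= n.+1)%N := ltn_ord k.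
  rewrite (big_ord_widen _ (fun i => (s%:M ^+ (k - i) * M ^+ i *+ 'C(k, i)) j 0) kn).
  rewrite big_mkcond; apply: eq_bigr => i _; rewrite !mxE.
  have [|ki] := ltnP; last by rewrite bin_small // mulr0n mulr0.
  rewrite -rmorphXn /= mulmxnE mulrnAr [_%:M * _]mul_scalar_mx !mxE.
  by rewrite mulrC.
rewrite det_mulmx; have -> : \det T = 1; last by rewrite mulr1.
rewrite -det_tr det_trig.
  by rewrite big1 // => i _; rewrite !mxE subnn binn expr0.
by apply/is_trig_mxP => a b ab; rewrite !mxE bin_small // mulr0n.
Qed.

(** Since Y M = 0, the row Y pairs to 0 with every Krylov column except e_0; multiplying by the
    adjugate recovers Y. *)
Lemma kvecP M (Y : 'rV_n.+1) j : Y *m M = 0 ->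
  kdet M * Y 0 j = Y 0 0 * kvec M 0 j.
Proof.
move=> YM.
have YK : Y *m krylov M = Y 0 0 *: delta_mx 0 0.
  apply/rowP => k; rewrite !mxE eqxx /=.
  have E : \sum_j Y 0 j * krylov M j k = (Y *m M ^+ k) 0 0.
    by rewrite mxE; apply: eq_bigr => i _; rewrite mxE.
  rewrite E; case: k {E} => [[|k] lk]; first by rewrite expr0 mulmx1 mulr1.
  by rewrite exprS mulmxA YM mul0mx mxE mulr0.
have := congr1 (fun B => (B *m \adj (krylov M)) 0 j) YK.
by rewrite -mulmxA mul_mx_adj mul_mx_scalar -scalemxAl -rowE !mxE => ->.
Qed.

Lemma kvec0 M : kvec M 0 0 = kdet M.
Proof.
have := mul_adj_mx (krylov M) => /matrixP/(_ 0 0); rewrite !mxE eqxx mulr1n /kdet => <-.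
rewrite (bigD1 0) //= big1 ?addr0 => [|j nj]; first by rewrite !mxE /= mulr1.
by rewrite !mxE /= (negPf nj) mulr0.
Qed.

(* By Cayley-Hamilton: kvec M kills the columns M, .., M^n of the Krylov
   sequence, and M^(n+1) up to the constant coefficient of char_poly M. *)
Lemma kvec_mul M : exists v : 'rV[R]_n.+1,
  kdet M *: (kvec M *m M) = (\det M * kdet M) *: v.
Proof.
have gM k : (0 < k <= n)%N -> (kvec M *m M ^+ k) 0 0 = 0.
  move=> /andP[k0 kn].
  have lk : (k < n.+1)%N by [].
  have -> : (kvec M *m M ^+ k) 0 0 = (\adj (krylov M) *m krylov M) 0 (Ordinal lk).
    by rewrite !mxE; apply: eq_bigr => i _; rewrite !mxE.
  by rewrite mul_adj_mx mxE; case: k k0 {kn} lk.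
have gMn : (kvec M *m M ^+ n.+1) 0 0 = - ((-1) ^+ n.+1 * \det M) * kdet M.
  have := Cayley_Hamilton M => /(congr1 (fun B => (kvec M *m B) 0 0)).
  have sz : (size (map_poly (@scalar_mx R n.+1) (char_poly M)) <= n.+2)%N.
    by rewrite -(size_char_poly M) size_poly.
  rewrite mulmx0 [X in _ = X -> _]mxE /horner_mx /horner_morph (horner_coef_wide _ sz).
  rewrite mulmx_sumr summxE big_ord_recr /= coef_map /=.
  have /monicP := char_poly_monic M; rewrite lead_coefE size_char_poly /= => ->.
  rewrite mul1r big_ord_recl /= coef_map /= expr0 mulr1 char_poly_det.
  rewrite mul_mx_scalar mxE kvec0 big1 ?addr0 => [/eqP|k _].
    by rewrite addrC addr_eq0 mulNr => /eqP.
  by rewrite coef_map /= [_%:M * _]mul_scalar_mx -scalemxAr mxE gM ?mulr0 //= ltn_ord.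
exists (- (-1) ^+ n.+1 *: row ord_max (\adj (krylov M))).
have E : kvec M *m M *m krylov M =
    (- ((-1) ^+ n.+1 * \det M) * kdet M) *: delta_mx 0 ord_max.
  apply/rowP => k; rewrite !mxE eqxx /=.
  have -> : \sum_j (kvec M *m M) 0 j * krylov M j k = (kvec M *m M ^+ k.+1) 0 0.
    by rewrite exprS mulmxA mxE; apply: eq_bigr => i _; rewrite [krylov _ _ _]mxE.
  have [->|nk] := eqVneq k ord_max; first by rewrite mulr1.
  rewrite mulr0 gM //=; have := ltn_ord k; move: nk; rewrite -val_eqE /= => /eqP; lia.
have := congr1 (mulmxr (\adj (krylov M))) E.
rewrite /= -[_ *m \adj _]mulmxA mul_mx_adj mul_mx_scalar => ->.
rewrite -scalemxAl -rowE scalerA; congr (_ *: _); rewrite -/(kdet M); ring.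
Qed.

(** For an upper Hessenberg matrix the Krylov matrix is upper triangular, with the powers of the
    subdiagonal entry on its diagonal. *)
Lemma kdet_hessenberg M z :
  (forall j l : 'I_n.+1, (l.+1 < j)%N -> M j l = 0) ->
  (forall j l : 'I_n.+1, (j = l.+1 :> nat)%N -> M j l = z) ->
  kdet M = \prod_(k < n.+1) z ^+ k.
Proof.
move=> M0 Mz.
have K k (j : 'I_n.+1) : (k <= j)%N -> (M ^+ k) j 0 = z ^+ k *+ (k == j :> nat).
  elim: k j => [|k IH] j; first by rewrite !expr0 mxE eq_sym.
  move=> kj; rewrite exprS mxE.
  have lk : (k < n.+1)%N by apply: leq_trans (ltn_ord j); rewrite ltnS ltnW.
  rewrite (bigD1 (Ordinal lk)) //= IH //= eqxx mulr1n big1 ?addr0 => [|l nl].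
    move: kj; rewrite leq_eqVlt => /predU1P[kj|kj].
      by rewrite (Mz _ (Ordinal lk)) -?kj // eqxx exprS.
    by rewrite M0 // mul0r (ltn_eqF kj).
  have [lk'|kl] := ltnP l k; first by rewrite M0 ?mul0r //= (leq_ltn_trans lk').
  have ne : (k == l) = false by apply/eqP => E; move: nl; rewrite -val_eqE /= E eqxx.
  by rewrite IH // ne mulr0.
rewrite /kdet -det_tr det_trig.
  by apply: eq_bigr => k _; rewrite !mxE K // eqxx.
apply/is_trig_mxP => i j ij; rewrite !mxE K; last exact: ltnW.
by rewrite (ltn_eqF ij).
Qed.

End Krylov.

Lemma map_krylov (R R' : comNzRingType) (f : {rmorphism R -> R'}) n
  (M : 'M[R]_n.+1) : map_mx f (krylov M) = krylov (map_mx f M).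
Proof. by apply/matrixP => j k; rewrite !mxE -rmorphXn /= mxE. Qed.

Lemma map_kdet (R R' : comNzRingType) (f : {rmorphism R -> R'}) n
  (M : 'M[R]_n.+1) : f (kdet M) = kdet (map_mx f M).
Proof. by rewrite /kdet -det_map_mx map_krylov. Qed.

Lemma map_kvec (R R' : comNzRingType) (f : {rmorphism R -> R'}) n
  (M : 'M[R]_n.+1) : map_mx f (kvec M) = kvec (map_mx f M).
Proof. by rewrite /kvec map_row map_mx_adj map_krylov. Qed.

(** * Monic deformations *)

Section PolynomialDegree.
Variable R : comNzRingType.

Lemma coef_prod_top (I : Type) (r : seq I) (d : I -> nat) (A : I -> {poly R}) :
  (forall i, (size (A i) <= (d i).+1)%N) ->
  (size (\prod_(i <- r) A i)%R <= (\sum_(i <- r) d i).+1)%N /\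
  (\prod_(i <- r) A i)`_(\sum_(i <- r) d i) = \prod_(i <- r) (A i)`_(d i).
Proof.
move=> sA; elim: r => [|i r [IHs IHc]]; first by rewrite !big_nil size_poly1 coef1.
rewrite !big_cons; split.
  by apply: leq_trans (size_polyMleq _ _) _; have := sA i; lia.
rewrite coefM -IHc.
have lt : (d i < (d i + \sum_(j <- r) d j).+1)%N by rewrite ltnS leq_addr.
rewrite (bigD1 (Ordinal lt)) //= addKn [X in _ + X]big1 ?addr0 // => j; rewrite -val_eqE /= => nj.
have [ji|ij] := ltnP j (d i).
  rewrite [X in _ * X]nth_default ?mulr0 //.
  by apply: leq_trans IHs _; lia.
by rewrite nth_default ?mul0r //; apply: leq_trans (sA i) _; move/eqP: nj; lia.
Qed.

(** The degree bounds depend on the column only, so every term of the Leibniz expansion has the same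
    bound, and the top coefficients form a determinant again. *)
Lemma coef_det_top n (d : 'I_n -> nat) (A : 'M[{poly R}]_n) :
  (forall j k, (size (A j k) <= (d k).+1)%N) ->
  (size (\det A) <= (\sum_k d k).+1)%N /\
  (\det A)`_(\sum_k d k) = \det (\matrix_(j, k) (A j k)`_(d k)).
Proof.
move=> sA.
have top (s : 'S_n) :
    (size (\prod_i A i (s i))%R <= (\sum_k d k).+1)%N /\
    (\prod_i A i (s i))`_(\sum_k d k) = \prod_i (A i (s i))`_(d (s i)).
  have E : (\sum_k d k = \sum_i d (s i))%N.
    by rewrite (reindex_inj (@perm_inj _ s)).
  by rewrite E; apply: coef_prod_top.
split.
  apply: leq_trans (size_sum _ _ _) _.
  apply/bigmax_leqP => s _.
  by rewrite mulr_sign; case: (odd_perm s); rewrite ?size_polyN; case: (top s).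
rewrite coef_sum; apply: eq_bigr => s _.
have [_ topE] := top s; rewrite !mulr_sign.
have -> : \prod_i (\matrix_(j, k) (A j k)`_(d k)) i (s i) =
  \prod_i (A i (s i))`_(d (s i)) by apply: eq_bigr => i _; rewrite mxE.
by case: (odd_perm s); rewrite ?coefN topE.
Qed.

Lemma coef_exp_top n (A B : 'M[R]_n.+1) k j l :
  let P := (map_mx polyC A + 'X *: map_mx polyC B) ^+ k in
  (size (P j l) <= k.+1)%N /\ (P j l)`_k = (B ^+ k) j l.
Proof.
elim: k j l => [|k IH] j l /=.
  by rewrite !expr0 !mxE; case: (j == l); rewrite ?size_poly1 ?size_poly0 ?coef1 ?coef0.
rewrite !exprS -!mulmxE [(_ *m _) j l]mxE [(B *m _) j l]mxE.
set P := _ ^+ k in IH *.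
have szE i : (size ((map_mx polyC A + 'X *: map_mx polyC B)%R j i) <= 2)%N.
  rewrite !mxE mulrC; apply: leq_trans (size_polyD _ _) _.
  rewrite geq_max (leq_trans (size_polyC_leq1 _)) //=.
  by apply: leq_trans (size_polyMleq _ _) _; rewrite size_polyX addn2 /= ltnS size_polyC_leq1.
split.
  apply: leq_trans (size_sum _ _ _) _.
  apply/bigmax_leqP => i _; apply: leq_trans (size_polyMleq _ _) _.
  have [sP _] := IH i l.
  by rewrite -subn1 leq_subLR; apply: leq_trans (leq_add (szE i) sP) _.
rewrite coef_sum; apply: eq_bigr => i _; have [sP cP] := IH i l.
rewrite -cP !mxE mulrDl coefD coefCM -mulrA coefXM /= coefCM.
by rewrite nth_default ?mulr0 ?add0r.
Qed.

End PolynomialDegree.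

Section Shift.
Variable n : nat.

(** The nilpotent shift sending e_k to e_(k+1); its Krylov matrix is the identity. *)
Definition shift_mx (T : nzRingType) : 'M[T]_n.+1 := \matrix_(j, k) (j == k.+1 :> nat)%:R.

Definition rev_mx (T : Type) (M : 'M[T]_n.+1) : 'M[T]_n.+1 :=
  \matrix_(j, k) M (rev_ord j) (rev_ord k).

Lemma map_shift_mx (T T' : nzRingType) (f : {rmorphism T -> T'}) :
  map_mx f (shift_mx T) = shift_mx T'.
Proof. by apply/matrixP => j k; rewrite !mxE rmorph_nat. Qed.

Lemma rev_shift_mx (T : nzRingType) : rev_mx (shift_mx T) = (shift_mx T)^T.
Proof.
apply/matrixP => j k; rewrite !mxE /=; congr (nat_of_bool _)%:R.
by apply/eqP/eqP; have := ltn_ord j; have := ltn_ord k; lia.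
Qed.

Lemma map_rev_mx (T T' : Type) (f : T -> T') (M : 'M[T]_n.+1) :
  map_mx f (rev_mx M) = rev_mx (map_mx f M).
Proof. by apply/matrixP => j k; rewrite !mxE. Qed.

Lemma kdet_shift_mx (T : comNzRingType) : kdet (shift_mx T) = 1.
Proof.
rewrite (@kdet_hessenberg _ _ _ 1) => [|j l jl|j l jl]; rewrite ?mxE ?jl ?eqxx //.
  by rewrite big1 // => k _; rewrite expr1n.
by rewrite gtn_eqF.
Qed.

Section Perturbation.
Variables (T : comNzRingType) (M : 'M[T]_n.+1).
Let D := (\sum_(k < n.+1) k)%N.
Local Notation P1 := (kdet (map_mx polyC M + 'X *: shift_mx {poly T})).

(** Column k of the Krylov matrix has degree at most k in the variable, and its coefficient of
    degree k is the k-th Krylov column of the shift. *)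
Lemma kdet_perturb_top : (size P1 <= D.+1)%N /\ P1`_D = 1.
Proof.
rewrite -[shift_mx {poly T}](map_shift_mx polyC) /kdet.
have sK (j k : 'I_n.+1) :
    (size (krylov (map_mx polyC M + 'X *: map_mx polyC (shift_mx T))%R j k) <= k.+1)%N.
  by rewrite mxE; case: (coef_exp_top M (shift_mx T) k j 0).
have [sD cD] := coef_det_top sK; split=> //.
rewrite cD -(kdet_shift_mx T); congr (\det _); apply/matrixP => j k; rewrite !mxE.
by case: (coef_exp_top M (shift_mx T) k j 0).
Qed.

Lemma kdet_perturb_monic : P1 \is monic.
Proof.
have [sD cD] := kdet_perturb_top.
rewrite monicE lead_coefE (_ : size P1 = D.+1) ?cD //.
apply/eqP; rewrite eqn_leq sD ltnNge; apply/negP => szD.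
by move/eqP: cD; rewrite nth_default // eq_sym oner_eq0.
Qed.

End Perturbation.
End Shift.

(* A resultant that does not vanish after specialization does not vanish. *)
Lemma monic_regular (R R' : idomainType) (xi : {rmorphism R -> R'})
  (p q b c : {poly R}) :
  p \is monic -> coprimep (map_poly xi p) (map_poly xi q) ->
  q * b = p * c -> exists d, b = p * d.
Proof.
(* Adding a multiple of [p] makes the second polynomial monic, so both leading coefficients survive
   specialization, and coprimality with [p] is unchanged. *)
move=> mp cop E; pose q' := q + p * 'X^(size q).
have mq' : q' \is monic.
  rewrite monicE lead_coefDr; first by rewrite -monicE monicMl ?monicXn.
  rewrite size_monicM ?monic_neq0 ?monicXn // size_polyXn addnS /=.
  by rewrite -[X in (X < _)%N]add0n ltn_add2r lt0n size_poly_eq0 monic_neq0.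
(* Coefficients are read as constants of a further polynomial ring; [f] sets its variable to 0 and
   then applies [xi]. *)
pose f : {rmorphism {poly R} -> R'} := xi \o horner_eval (0 : R).
have mapf (r : {poly R}) : map_poly f (map_poly polyC r) = map_poly xi r.
  by apply/polyP => i; rewrite !coef_map /= /horner_eval hornerC.
pose p1 := map_poly polyC p; pose q1 := map_poly polyC q'.
have [mp1 mq1] : p1 \is monic /\ q1 \is monic by split; apply: monic_map.
have cop1 : coprimep p1 q1.
  have res : resultant p1 q1 != 0.
    apply/eqP => /(congr1 f); rewrite (map_resultant (f := f)); first last.
    - by rewrite (monicP mq1) rmorph1 oner_eq0.
    - by rewrite (monicP mp1) rmorph1 oner_eq0.
    rewrite rmorph0 !mapf => /eqP; rewrite resultant_eq0 => sg.
    have : coprimep (map_poly xi p) (map_poly xi q').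
      by rewrite rmorphD rmorphM addrC mulrC coprimep_addl_mul.
    by rewrite /coprimep => /eqP E1; rewrite (_ : size _ = 1%N) in sg.
  move: res; rewrite resultant_eq0 -leqNgt => sg.
  rewrite /coprimep eqn_leq sg lt0n size_poly_eq0 gcdp_eq0.
  by rewrite (negPf (monic_neq0 mp1)).
have : p1 %| q1 * map_poly polyC b.
  rewrite /q1 -rmorphM mulrDl E -mulrA -mulrDr rmorphM.
  exact: dvdp_mulIl.
rewrite Gauss_dvdpr // => /(Pdiv.IdomainMonic.dvdpP mp1)[d Ed].
exists (map_poly (horner_eval (0 : R)) d).
have map0 (r : {poly R}) : map_poly (horner_eval (0 : R)) (map_poly polyC r) = r.
  by apply/polyP => i; rewrite !coef_map /= /horner_eval hornerC.
by rewrite -[b]map0 Ed rmorphM /= /p1 map0 mulrC.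
Qed.

(* Where M specializes to the transposed shift, kdet P specializes to a power of
   X and kdet (rev_mx P) to 1. *)
Lemma kdet_perturb_regular (R R' : idomainType) n (xi : {rmorphism R -> R'})
  (M : 'M[R]_n.+1) (b c : {poly R}) :
  map_mx xi M = (shift_mx n R')^T ->
  let P := map_mx polyC M + 'X *: shift_mx n {poly R} in
  kdet (rev_mx P) * b = kdet P * c -> exists d, b = kdet P * d.
Proof.
move=> xiM P; apply: (@monic_regular _ _ xi); first exact: kdet_perturb_monic.
pose J := shift_mx n {poly R'}.
have -> : map_poly xi (kdet P) = 'X ^+ (\sum_(k < n.+1) k).
  rewrite map_kdet -prodrXr.
  have -> : map_mx (map_poly xi) P = J^T + 'X *: J.
    rewrite /P map_mxD map_mxZ /= map_polyX map_shift_mx; congr (_ + _).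
    rewrite -map_mx_comp (_ : map_mx _ M = map_mx polyC (map_mx xi M)).
      by rewrite xiM -map_trmx map_shift_mx.
    by apply/matrixP => j k; rewrite !mxE /= map_polyC.
  apply: kdet_hessenberg => j l jl; rewrite !mxE.
    have [-> ->] : (l == j.+1 :> nat) = false /\ (j == l.+1 :> nat) = false.
      by split; apply/eqP; lia.
    by rewrite mulr0 addr0.
  have -> : (l == j.+1 :> nat) = false by apply/eqP; lia.
  by rewrite jl eqxx mulr1 add0r.
have -> : map_poly xi (kdet (rev_mx P)) = 1; last exact: coprimep1.
rewrite map_kdet map_rev_mx.
have -> : rev_mx (map_mx (map_poly xi) P) = J + 'X *: J^T.
  rewrite /P map_mxD map_mxZ /= map_polyX map_shift_mx.
  rewrite -map_mx_comp (_ : map_mx _ M = map_mx polyC (map_mx xi M)); last first.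
    by apply/matrixP => j k; rewrite !mxE /= map_polyC.
  rewrite xiM -map_trmx map_shift_mx -rev_shift_mx.
  by apply/matrixP => j k; rewrite !mxE !rev_ordK.
rewrite (@kdet_hessenberg _ _ _ 1) => [|j l jl|j l jl]; rewrite ?mxE.
- by rewrite big1 // => k _; rewrite expr1n.
- have [-> ->] : (l == j.+1 :> nat) = false /\ (j == l.+1 :> nat) = false.
    by split; apply/eqP; lia.
  by rewrite mulr0 addr0.
- have -> : (l == j.+1 :> nat) = false by apply/eqP; lia.
  by rewrite jl eqxx mulr0 addr0.
Qed.

(** First the factors [d2] are removed one at a time against a single [d1]; then induction on [N]
    cancels one [d1] from both sides at each step. *)
Lemma regular_pow (R : idomainType) (d1 d2 : R) N N' :
  (forall x y, d2 * x = d1 * y -> exists z, x = d1 * z) ->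
  forall x y, d2 ^+ N' * x = d1 ^+ N * y -> exists z, x = d1 ^+ N * z.
Proof.
move=> reg.
have reg2 x y : d2 ^+ N' * x = d1 * y -> exists z, x = d1 * z.
  elim: N' x y => [|k IH] x y; first by rewrite mul1r => ->; exists y.
  by rewrite exprSr -mulrA => /IH[z] /reg.
elim: N => [|N IH] x y E; first by exists x; rewrite mul1r.
have [|z Ez] := reg2 x (d1 ^+ N * y); first by rewrite E exprS mulrA.
(* Cancelling [d1] requires it to be nonzero; if it is zero then [x] is zero as well. *)
have [d0|d0] := eqVneq d1 0; first by exists 0; rewrite mulr0 Ez d0 mul0r.
have [|w Ew] := IH z y; last by exists w; rewrite Ez Ew exprS mulrA.
by apply: (mulfI d0); rewrite mulrCA -Ez E exprS mulrA.
Qed.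

Section MonicDeformation.
Variables (R : idomainType) (tau : {rmorphism R -> {poly R}}).
Hypothesis tau0 : forall r, (tau r).[0] = r.
Variable c : R.
Hypothesis tau_c : tau c \is monic.

(** Division with remainder by the monic [tau c] is linear over constants, and [tau d] is a
    constant. Hence [d] times the remainder of [tau q] is zero, so the remainder is zero; setting
    the variable to 0 gives the quotient in [R]. *)
Lemma monic_torsion_free d q r : d != 0 -> tau d = d%:P -> d * q = c * r ->
  exists s, q = c * s.
Proof.
move=> d0 td E; have /(congr1 (fun p => Pdiv.Ring.rmodp p (tau c))) :
  d *: tau q = tau r * tau c by rewrite -mul_polyC -td -!rmorphM E mulrC.
rewrite /= Pdiv.RingMonic.rmodpZ // Pdiv.RingMonic.rmodp_mull // => /eqP.
rewrite -mul_polyC mulf_eq0 polyC_eq0 (negPf d0) /= => /eqP q0.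
exists (Pdiv.Ring.rdivp (tau q) (tau c)).[0].
rewrite -{1}(tau0 q) {1}(Pdiv.RingMonic.rdivp_eq tau_c (tau q)) q0 addr0.
by rewrite hornerM tau0 mulrC.
Qed.

(* Hartogs' extension across d1 = d2 = 0, in R / (c), which is free over the
   tau-invariants. *)
Lemma monic_hartogs d1 d2 a b r : tau d1 = d1%:P -> tau d2 = d2%:P ->
  (forall x y, d2 * x = d1 * y -> exists z, x = d1 * z) ->
  d2 * a - d1 * b = c * r -> exists s t, a = d1 * s + c * t.
Proof.
move=> t1 t2 reg E.
pose md p := Pdiv.Ring.rmodp p (tau c).
have Emod : d2 *: md (tau a) = d1 *: md (tau b).
  apply/eqP; rewrite -subr_eq0 -!Pdiv.RingMonic.rmodpZ // -Pdiv.RingMonic.rmodpB //.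
  rewrite -!mul_polyC -t1 -t2 -!rmorphM -rmorphB E rmorphM mulrC.
  by rewrite Pdiv.RingMonic.rmodp_mull.
(* The relation between the remainders holds coefficient by coefficient, so regularity applies to
   each coefficient. *)
have coefE k : exists z, (md (tau a))`_k = d1 * z.
  apply: (reg _ (md (tau b))`_k); rewrite -!coefZ Emod.
  by [].
have [z Ez] := choice coefE.
pose s := \poly_(k < size (md (tau a))) z k.
have Es : md (tau a) = d1 *: s.
  apply/polyP => k; rewrite coefZ coef_poly; case: ltnP => [_|ks]; first exact: Ez.
  by rewrite mulr0 nth_default.
exists s.[0], (Pdiv.Ring.rdivp (tau a) (tau c)).[0].
rewrite -{1}(tau0 a) {1}(Pdiv.RingMonic.rdivp_eq tau_c (tau a)) -/(md _) Es.
by rewrite hornerD hornerZ hornerM tau0 addrC mulrC [X in _ + X]mulrC mulrC.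
Qed.

End MonicDeformation.

(** * The generic point of the incidence variety *)

Section Pencil.
Variables (R : idomainType) (n : nat) (M : 'M[R]_n.+1).
Variables (tau tau' : {rmorphism R -> {poly R}}) (xi : {rmorphism R -> int}).
Hypotheses (tau0 : forall r, (tau r).[0] = r) (tau'0 : forall r, (tau' r).[0] = r).
Hypothesis tauM : map_mx tau M = map_mx polyC M + 'X%:M.
Hypothesis tau'M : map_mx tau' M = map_mx polyC M + 'X *: shift_mx n {poly R}.
Hypothesis xiM : map_mx xi M = (shift_mx n int)^T.
Local Notation d1 := (kdet M).
Local Notation d2 := (kdet (rev_mx M)).

(** This is the characteristic polynomial of [- M]. *)
Lemma pencil_det_monic : tau (\det M) \is monic.
Proof.
have := char_poly_monic (- M); rewrite /char_poly /char_poly_mx -det_map_mx tauM.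
by rewrite raddfN /= opprK addrC.
Qed.

Lemma pencil_kdet_tau : tau d1 = d1%:P.
Proof. by rewrite map_kdet tauM kdet_shift map_kdet. Qed.

Lemma pencil_kdet_rev_tau : tau d2 = d2%:P.
Proof.
rewrite map_kdet map_rev_mx tauM (_ : rev_mx _ = map_mx polyC (rev_mx M) + 'X%:M).
  by rewrite kdet_shift map_kdet.
by apply/matrixP => j k; rewrite !mxE (inj_eq rev_ord_inj).
Qed.

Lemma pencil_kdet_neq0 : d1 != 0.
Proof.
apply/eqP => d0; have := monic_neq0 (kdet_perturb_monic M).
by rewrite -tau'M -map_kdet d0 rmorph0 eqxx.
Qed.

(** At the point [xi] the matrix is nilpotent, so its determinant specializes to 0. *)
Lemma pencil_det_nonunit s : \det M * s <> 1.
Proof.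
move=> /(congr1 xi); rewrite rmorphM -det_map_mx xiM det_tr rmorph1.
suff -> : \det (shift_mx n int) = 0 by rewrite mul0r.
rewrite det_trig; last first.
  by apply/is_trig_mxP => j k jk; rewrite mxE ltn_eqF // ltnW // ltnS.
by rewrite (bigD1 0) //= mxE mul0r.
Qed.

Lemma pencil_torsion_free N q r :
  d1 ^+ N * q = \det M * r -> exists s, q = \det M * s.
Proof.
apply: (monic_torsion_free tau0 pencil_det_monic).
  by rewrite expf_neq0 // pencil_kdet_neq0.
by rewrite !rmorphXn /= pencil_kdet_tau.
Qed.

Lemma pencil_hartogs N N' a b r : d2 ^+ N' * a - d1 ^+ N * b = \det M * r ->
  exists s t, a = d1 ^+ N * s + \det M * t.
Proof.
apply: (monic_hartogs tau0 pencil_det_monic).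
- by rewrite !rmorphXn /= pencil_kdet_tau.
- by rewrite !rmorphXn /= pencil_kdet_rev_tau.
(* Regularity is checked after the deformation [tau'], where [kdet] is monic; setting the variable
   to 0 returns to [R]. *)
apply: regular_pow => x y /(congr1 tau'); rewrite !rmorphM !map_kdet map_rev_mx tau'M.
move=> /(kdet_perturb_regular xiM)[z /(congr1 (horner_eval (0 : R)))].
rewrite rmorphM /= /horner_eval tau'0 -tau'M -map_kdet tau'0 => ->.
by exists z.[0].
Qed.

End Pencil.

Lemma sum_ord2 (V : nmodType) (f : 'I_2 -> V) : \sum_i f i = f 0 + f 1.
Proof.
by rewrite !big_ord_recl big_ord0 addr0; congr (_ + f _); apply: val_inj.
Qed.

Definition incidence (T : comNzRingType) n (u : 'I_2 -> 'I_n -> 'I_n -> T)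
  (x : 'I_2 -> T) (y : 'I_n -> T) :=
  forall k, \sum_i \sum_j u i j k * x i * y j = 0.

(* The generic point of the incidence variety y C(x) = 0: it specializes to
   every point, in an integral domain, whose first x- and y-coordinates do not
   vanish. *)
Record generic_incidence n := GenericIncidence {
  gi_field : fieldType;
  gi_u : 'I_2 -> 'I_n.+1 -> 'I_n.+1 -> gi_field;
  gi_x : 'I_2 -> gi_field;
  gi_y : 'I_n.+1 -> gi_field;
  gi_x_neq0 : forall l, gi_x l != 0;
  gi_y_neq0 : forall j, gi_y j != 0;
  gi_incidence : incidence gi_u gi_x gi_y;
  gi_specialize_x : forall (T : idomainType) u x y, @incidence T _ u x y ->
    x 0 != 0 -> y 0 != 0 -> forall i, x i = 1 -> forall p,
    ev gi_u (fun l => gi_x l / gi_x i) p = 0 -> ev u x p = 0;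
  gi_specialize_y : forall (T : idomainType) u x y, @incidence T _ u x y ->
    x 0 != 0 -> y 0 != 0 -> forall j, y j = 1 -> forall p,
    ev gi_u (fun l => gi_y l / gi_y j) p = 0 -> ev u y p = 0
}.

Section GenericIncidence.
Variables (n : nat) (G : idomainType).
Variables (u : 'I_2 -> 'I_n.+1 -> 'I_n.+1 -> G) (x : 'I_2 -> G) (y : 'I_n.+1 -> G).
Hypotheses (x_neq0 : forall l, x l != 0) (y_neq0 : forall j, y j != 0).
Hypothesis univ : forall (T : idomainType) u' x' y', exists e : {rmorphism G -> T},
  [/\ forall i j k, e (u i j k) = u' i j k, forall l, e (x l) = x' l
    & forall j, e (y j) = y' j].

(* The incidence equations are solved for the u_00k. *)
Definition other_terms k : G :=
  \sum_i \sum_j (if (i == 0) && (j == 0) then 0 else u i j k * x i * y j).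

Definition solved_u i j k : {fraction G} :=
  if (i == 0) && (j == 0) then - (other_terms k)%:F / (x 0 * y 0)%:F
  else (u i j k)%:F.

Lemma sum_split00 (T : comNzRingType) (f : 'I_2 -> 'I_n.+1 -> T) :
  \sum_i \sum_j f i j =
  f 0 0 + \sum_i \sum_j (if (i == 0) && (j == 0) then 0 else f i j).
Proof.
rewrite (bigD1 0) //= [in RHS](bigD1 0) //= addrA; congr (_ + _); last first.
  by apply: eq_bigr => i /negPf ->.
rewrite (bigD1 0) //= [in RHS](bigD1 0) //= add0r; congr (_ + _).
by apply: eq_bigr => j /negPf ->.
Qed.

Lemma solved_incidence :
  incidence solved_u (fun l => (x l)%:F) (fun j => (y j)%:F).
Proof.
move=> k; rewrite sum_split00 /solved_u /=.
have xy0 : (x 0 * y 0)%:F != 0 by rewrite tofrac_eq0 mulf_neq0.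
have E : (other_terms k)%:F = \sum_i \sum_j
    (if (i == 0) && (j == 0) then 0 else (u i j k * x i * y j)%:F).
  rewrite rmorph_sum; apply: eq_bigr => i _; rewrite rmorph_sum.
  by apply: eq_bigr => j _; case: ifP => _ /=; rewrite ?tofrac0.
rewrite -mulrA -tofracM divfK // E addrC; apply/eqP; rewrite subr_eq0; apply/eqP.
apply: eq_bigr => i _; apply: eq_bigr => j _.
by have [c|c] := ifP; rewrite /= ?c ?tofracM.
Qed.

Section Specialize.
Variables (T : idomainType) (u' : 'I_2 -> 'I_n.+1 -> 'I_n.+1 -> T).
Variables (x' : 'I_2 -> T) (y' : 'I_n.+1 -> T).
Hypotheses (inc : incidence u' x' y') (x'0 : x' 0 != 0) (y'0 : y' 0 != 0).
Variable e : {rmorphism G -> T}.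
Hypotheses (eu : forall i j k, e (u i j k) = u' i j k).
Hypotheses (ex : forall l, e (x l) = x' l) (ey : forall j, e (y j) = y' j).

Let rel (w : {fraction G}) (w' : T) := exists a b,
  [/\ b != 0, e b != 0, w * b%:F = a%:F & w' * e b = e a].

(** [rel] is the graph of the extension of [e] to the fractions whose denominator has nonzero image.
    The denominator [x 0 * y 0] of the solved coefficients is of this kind, and a value 0 can only
    specialize to 0. *)
Lemma specialize m (z : 'I_m -> {fraction G}) z' p : (forall l, rel (z l) (z' l)) ->
  ev solved_u z p = 0 -> ev u' z' p = 0.
Proof.
move=> zrel; suff : rel (ev solved_u z p) (ev u' z' p).
  move=> [a [b [b0 eb0 E E']]] ev0; move: E E'; rewrite ev0 mul0r => /esym/eqP.
  rewrite tofrac_eq0 => /eqP ->; rewrite rmorph0 => /eqP.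
  by rewrite mulf_eq0 (negPf eb0) orbF => /eqP.
apply: ev_rel => //.
- by exists 1, 1; rewrite rmorph1 tofrac1 !mulr1 !oner_eq0.
- move=> w w' [a [b [b0 eb0 E E']]]; exists (- a), b; split=> //.
    by rewrite mulNr E tofracN.
  by rewrite mulNr E' rmorphN.
- move=> w w' v v' [a [b [b0 eb0 E E']]] [c [d [d0 ed0 F F']]].
  exists (a * d + c * b), (b * d); rewrite mulf_neq0 // rmorphM mulf_neq0 //.
  split=> //; first by rewrite tofracD !tofracM -E -F; ring.
  by rewrite rmorphD !rmorphM -E' -F'; ring.
- move=> w w' v v' [a [b [b0 eb0 E E']]] [c [d [d0 ed0 F F']]].
  exists (a * c), (b * d); rewrite mulf_neq0 // rmorphM mulf_neq0 //.
  split=> //; first by rewrite !tofracM -E -F; ring.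
  by rewrite !rmorphM -E' -F'; ring.
move=> i j k; rewrite /solved_u; case: ifP => [/andP[/eqP -> /eqP ->]|_]; last first.
  by exists (u i j k), 1; rewrite rmorph1 tofrac1 !mulr1 !oner_eq0.
have xy0 : (x 0 * y 0)%:F != 0 by rewrite tofrac_eq0 mulf_neq0.
have exy : e (x 0 * y 0) = x' 0 * y' 0 by rewrite rmorphM ex ey.
exists (- other_terms k), (x 0 * y 0); split.
- by rewrite mulf_neq0.
- by rewrite exy mulf_neq0.
- by rewrite divfK // tofracN.
rewrite exy mulrA rmorphN; apply/eqP; rewrite -addr_eq0; apply/eqP.
(* The incidence equation at the target point forces the image of each solved coefficient to be
   [u' 0 0 k]. *)
rewrite -[RHS](inc k) [RHS]sum_split00; congr (_ + _).
rewrite /other_terms rmorph_sum; apply: eq_bigr => i' _; rewrite rmorph_sum; apply: eq_bigr => j' _.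
by case: ifP => _; rewrite ?rmorph0 // !rmorphM eu ex ey.
Qed.

End Specialize.

Lemma exists_generic_incidence : generic_incidence n.
Proof.
apply: (@GenericIncidence n {fraction G} solved_u (fun l => (x l)%:F) (fun j => (y j)%:F)).
- by move=> l; rewrite tofrac_eq0.
- by move=> l; rewrite tofrac_eq0.
- exact: solved_incidence.
- move=> T u' x' y' inc x'0 y'0 i xi p.
  have [e [eu ex ey]] := univ u' x' y'.
  apply: (specialize inc x'0 y'0 eu ex ey) => l; exists (x l), (x i).
  by rewrite !ex xi oner_eq0 mulr1 x_neq0 divfK // tofrac_eq0.
- move=> T u' x' y' inc x'0 y'0 i yi p.
  have [e [eu ex ey]] := univ u' x' y'.
  apply: (specialize inc x'0 y'0 eu ex ey) => l; exists (y l), (y i).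
  by rewrite !ey yi oner_eq0 mulr1 y_neq0 divfK // tofrac_eq0.
Qed.

End GenericIncidence.

(** * The charts with x_i = 1 *)

Definition pencil (T : comNzRingType) n (u : 'I_2 -> 'I_n -> 'I_n -> T)
  (x : 'I_2 -> T) : 'M[T]_n := \matrix_(j, k) \sum_l x l * u l j k.

Lemma map_pencil (T T' : comNzRingType) (f : {rmorphism T -> T'}) n
  (u : 'I_2 -> 'I_n -> 'I_n -> T) (x : 'I_2 -> T) u' x' :
  (forall i j k, f (u i j k) = u' i j k) -> (forall l, f (x l) = x' l) ->
  map_mx f (pencil u x) = pencil u' x'.
Proof.
move=> fu fx; apply/matrixP => j k; rewrite !mxE rmorph_sum.
by apply: eq_bigr => l _; rewrite rmorphM fx fu.
Qed.

Lemma pencil_incidence (T : comNzRingType) n (u : 'I_2 -> 'I_n -> 'I_n -> T)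
  (x : 'I_2 -> T) y : incidence u x y -> (\row_j y j) *m pencil u x = 0.
Proof.
move=> inc; apply/rowP => k; rewrite !mxE -[RHS](inc k) exchange_big.
by apply: eq_bigr => j _; rewrite !mxE mulr_sumr; apply: eq_bigr => l _; ring.
Qed.

Lemma incidence_det (T : idomainType) n (u : 'I_2 -> 'I_n -> 'I_n -> T)
  (x : 'I_2 -> T) y j : incidence u x y -> y j != 0 -> \det (pencil u x) = 0.
Proof.
move=> inc yj; apply: (mulIf yj).
have := congr1 (fun B : 'rV_n => (B *m \adj (pencil u x)) 0 j) (pencil_incidence inc).
by rewrite -mulmxA mul_mx_adj mul_mx_scalar mul0mx !mxE mul0r.
Qed.

Section XChart.
Variables (n : nat) (g : generic_incidence n).
Local Notation Q := (gi_field g).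
Local Notation U := (gi_u g).
Local Notation X := (gi_x g).
Local Notation Y := (gi_y g).
Variables (R : idomainType) (u : 'I_2 -> 'I_n.+1 -> 'I_n.+1 -> R).
Variables (x : 'I_2 -> R) (i : 'I_2).
Hypotheses (xi1 : x i = 1) (x0 : x 0 != 0).
Local Notation M := (pencil u x).
Variables (tau tau' : {rmorphism R -> {poly R}}) (xi : {rmorphism R -> int}).
Hypotheses (tau0 : forall r, (tau r).[0] = r) (tau'0 : forall r, (tau' r).[0] = r).
Hypothesis tauM : map_mx tau M = map_mx polyC M + 'X%:M.
Hypothesis tau'M : map_mx tau' M = map_mx polyC M + 'X *: shift_mx n {poly R}.
Hypothesis xiM : map_mx xi M = (shift_mx n int)^T.

(* Moving the entries u_i0k by a multiple of det M makes kvec M / kdet M a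
   point of the fibre over x, so the generic point specializes there. *)
Lemma x_chart_kernel p :
  ev U (fun l => X l / X i) p = 0 -> exists s, ev u x p = \det M * s.
Proof.
move=> p0; have [v] := kvec_mul M; have := kvec0 M.
move: (kvec M) => y; set c := \det M; set d := kdet M => yd Ev.
have d0 : d != 0 := pencil_kdet_neq0 tau'M.
have dF : d%:F != 0 by rewrite tofrac_eq0.
have yM k : \sum_j y 0 j * M j k = c * v 0 k.
  apply: (mulfI d0); have := congr1 (fun B : 'rV_n.+1 => B 0 k) Ev.
  by rewrite !mxE => ->; rewrite [c * d]mulrC mulrA.
pose y' j : {fraction R} := (y 0 j)%:F / d%:F.
pose u' l j k : {fraction R} := (u l j k)%:F -
  (if (l == i) && (j == 0) then (c * v 0 k)%:F / d%:F else 0).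
pose x' l : {fraction R} := (x l)%:F.
have y'0 : y' 0 = 1 by rewrite /y' yd divff.
have inc : incidence u' x' y'.
  move=> k.
  transitivity ((\sum_j y 0 j * M j k)%:F / d%:F - (c * v 0 k)%:F / d%:F); last first.
    by rewrite yM subrr.
  rewrite /u'; under eq_bigr do under eq_bigr do rewrite 2!mulrBl.
  under eq_bigr do rewrite sumrB.
  rewrite sumrB; congr (_ - _).
    rewrite exchange_big /= rmorph_sum mulr_suml; apply: eq_bigr => j _.
    rewrite !mxE mulr_sumr rmorph_sum mulr_suml; apply: eq_bigr => l _.
    by rewrite /= !tofracM /x' /y'; ring.
  rewrite (bigD1 i) //= [X in _ + X]big1 ?addr0 => [|l /negPf li]; last first.
    by rewrite big1 // => j _; rewrite li !mul0r.
  rewrite (bigD1 0) //= !eqxx /= big1 ?addr0 => [|j /negPf j0]; last first.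
    by rewrite j0 !mul0r.
  by rewrite y'0 /x' xi1 tofrac1 !mulr1.
have x'0 : x' 0 != 0 by rewrite /x' tofrac_eq0.
have y'n0 : y' 0 != 0 by rewrite y'0 oner_eq0.
have x'i : x' i = 1 by rewrite /x' xi1 tofrac1.
have p'0 := gi_specialize_x inc x'0 y'n0 x'i p0.
(* [w] and [r] are congruent modulo [c] once [d] is inverted. The moved coefficients satisfy this,
   hence so do all polynomial values; torsion-freeness then removes the power of [d]. *)
pose rel (w : {fraction R}) (r : R) :=
  exists N s, d%:F ^+ N * (w - r%:F) = (c * s)%:F.
have [N [s]] : rel (ev u' x' p) (ev u x p).
  apply: ev_rel.
  - by exists 0%N, 0; rewrite tofrac1 subrr !mulr0 tofrac0.
  - move=> w r [N [s E]]; exists N, (- s).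
    have -> : - w - (- r)%:F = - (w - r%:F) by rewrite tofracN opprD.
    by rewrite !mulrN E tofracN.
  - move=> w r w' r' [N [s E]] [N' [s' E']].
    exists (N + N')%N, (d ^+ N' * s + d ^+ N * s').
    have -> : d%:F ^+ (N + N') * (w + w' - (r + r')%:F) =
      d%:F ^+ N' * (d%:F ^+ N * (w - r%:F)) + d%:F ^+ N * (d%:F ^+ N' * (w' - r'%:F)).
      by rewrite tofracD exprD; ring.
    by rewrite E E' !(tofracM, tofracD, tofracXn); ring.
  - move=> w r w' r' [N [s E]] [N' [s' E']].
    exists (N + N')%N, (c * s * s' + s * r' * d ^+ N' + r * s' * d ^+ N).
    have -> : d%:F ^+ (N + N') * (w * w' - (r * r')%:F) =
      d%:F ^+ N * (w - r%:F) * (d%:F ^+ N' * (w' - r'%:F)) +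
      d%:F ^+ N * (w - r%:F) * r'%:F * d%:F ^+ N' +
      r%:F * (d%:F ^+ N' * (w' - r'%:F)) * d%:F ^+ N.
      by rewrite tofracM exprD; ring.
    by rewrite E E' !(tofracM, tofracD, tofracXn); ring.
  - move=> l j k; exists 1%N, (if (l == i) && (j == 0) then - v 0 k else 0).
    rewrite /u' addrC addKr expr1 mulrN; case: ifP => _; last by rewrite !mulr0 tofrac0 oppr0.
    by rewrite mulrCA divff // mulr1 mulrN tofracN.
  - by move=> l; exists 0%N, 0; rewrite /x' subrr !mulr0 tofrac0.
rewrite p'0 sub0r mulrN -tofracXn -tofracM -tofracN => /tofrac_inj E.
apply: (@pencil_torsion_free _ _ _ _ _ tau0 tauM tau'M N _ (- s)).
by rewrite mulrN -E opprK.
Qed.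

(** By Cramer's rule each quotient [y 0 k / y 0 0] is [kvec B 0 k / kdet B], so a polynomial in
    these quotients has a power of [kdet B] as denominator. *)
Lemma kdet_denominator (S : comNzRingType) (e : {rmorphism S -> Q})
  (B : 'M[S]_n.+1) (y : 'rV[Q]_n.+1) (h : 'I_n.+1 -> Q) q :
  (forall l j k, exists r, U l j k = e r) ->
  y 0 0 != 0 -> y *m map_mx e B = 0 -> (forall j, exists k, h j = y 0 k / y 0 0) ->
  exists N a, e (kdet B) ^+ N * ev U h q = e a.
Proof.
move=> Ue y0 yB hy.
apply: (@ev_pred _ (fun w => exists N a, e (kdet B) ^+ N * w = e a)).
- by exists 0%N, 1; rewrite mulr1 rmorph1.
- by move=> w [N [c E]]; exists N, (- c); rewrite mulrN E rmorphN.
- move=> w w' [N [c E]] [N' [c' E']].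
  exists (N + N')%N, (kdet B ^+ N' * c + kdet B ^+ N * c').
  by rewrite rmorphD !rmorphM !rmorphXn /= -E -E' exprD; ring.
- move=> w w' [N [c E]] [N' [c' E']].
  by exists (N + N')%N, (c * c'); rewrite rmorphM /= -E -E' exprD; ring.
- by move=> l j k; have [r ->] := Ue l j k; exists 0%N, r; rewrite mul1r.
- move=> j; have [k ->] := hy j; exists 1%N, (kvec B 0 k).
  have := kvecP k yB; rewrite -map_kvec -map_kdet mxE expr1 => E.
  by rewrite mulrA E mulrAC divff ?mul1r.
Qed.

(** Cross-multiplying the two expressions of [v] gives an element of the kernel of [e], that is, a
    multiple of the determinant over [R]. The Hartogs property then divides the numerator [a] by the
    power of [kdet] modulo the determinant. *)
Lemma pencil_extend (S : comNzRingType) (e : {rmorphism S -> Q})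
  (f : {rmorphism S -> R}) (rho : {rmorphism R -> Q}) (B : 'M[S]_n.+1) v N N' a b :
  (forall p, e p = 0 -> exists s, f p = \det M * s) ->
  (forall p, rho (f p) = e p) -> map_mx f B = M -> rho (\det M) = 0 ->
  e (kdet B) ^+ N * v = e a -> e (kdet (rev_mx B)) ^+ N' * v = e b ->
  exists r, v = rho r.
Proof.
move=> ker rhof fB rhodet Ea Eb.
have [|s] := ker (kdet (rev_mx B) ^+ N' * a - kdet B ^+ N * b).
  by rewrite rmorphB !rmorphM !rmorphXn /= -Ea -Eb mulrCA subrr.
rewrite rmorphB !rmorphM !rmorphXn /= !map_kdet map_rev_mx fB.
move=> /(pencil_hartogs tau0 tau'0 tauM tau'M xiM)[r [t Er]]; exists r.
(* Otherwise the determinant divides [kdet M], and by torsion-freeness it divides 1. *)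
have d0 : e (kdet B) != 0.
  apply/eqP => /ker[z Ez].
  have [|z' Ez'] := @pencil_torsion_free _ _ _ _ _ tau0 tauM tau'M 1 1 z.
    by rewrite mulr1 expr1 -Ez map_kdet fB.
  by case: (@pencil_det_nonunit _ _ _ _ xiM z').
apply: (mulfI (expf_neq0 N d0)).
rewrite Ea -rhof Er rmorphD !rmorphM rmorphXn /= rhodet mul0r addr0.
by rewrite -fB -map_kdet rhof.
Qed.

(** Two of the y-charts suffice: the first gives a denominator that is a power of [kdet], the last
    one, after reversal of the basis, a power of the reversed [kdet]. *)
Lemma x_chart_extend (rho : {rmorphism R -> Q}) v a b :
  (forall l j k, rho (u l j k) = U l j k) -> (forall l, rho (x l) = X l / X i) ->
  v = ev U (fun j => Y j / Y 0) a -> v = ev U (fun j => Y j / Y ord_max) b ->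
  exists r, v = rho r.
Proof.
move=> rhou rhox va vb.
pose e : {rmorphism {mpoly (Lambda n.+1)[2]} -> Q} := ev U (fun l => X l / X i).
have ker p : e p = 0 -> exists s, ev u x p = \det M * s by apply: x_chart_kernel.
pose MQ := pencil U (fun l => X l / X i).
have rhoM : map_mx rho M = MQ by apply: map_pencil.
have Xi0 := gi_x_neq0 g i.
have inc : incidence U (fun l => X l / X i) Y.
  move=> k; transitivity ((\sum_l \sum_j U l j k * X l * Y j) / X i); last first.
    by rewrite gi_incidence mul0r.
  rewrite mulr_suml; apply: eq_bigr => l _.
  by rewrite mulr_suml; apply: eq_bigr => j _; ring.
have YM : (\row_j Y j) *m MQ = 0 := pencil_incidence inc.
have YM' : (\row_j Y (rev_ord j)) *m rev_mx MQ = 0.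
  apply/rowP => k; have := congr1 (fun B : 'rV_n.+1 => B 0 (rev_ord k)) YM.
  rewrite !mxE => E; rewrite -[RHS]E (reindex_inj rev_ord_inj) /=.
  by apply: eq_bigr => j _; rewrite !mxE !rev_ordK.
pose Mp := pencil (fun l j k => (uvar l j k)%:MP) (fun l => 'X_l : {mpoly (Lambda n.+1)[2]}).
have evMp (T : comNzRingType) (w : 'I_2 -> 'I_n.+1 -> 'I_n.+1 -> T) z :
    map_mx (ev w z) Mp = pencil w z.
  by apply: map_pencil => [l j k|l]; [exact: ev_uvar|exact: evX].
have Ue l j k : exists r, U l j k = e r.
  by exists (uvar l j k)%:MP; symmetry; apply: ev_uvar.
have Y0 := gi_y_neq0 g.
have evM : map_mx (ev u x) Mp = M by apply: evMp.
have eM : map_mx e Mp = MQ by apply: evMp.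
have [|||N [a' Ea]] :=
  @kdet_denominator _ e Mp (\row_j Y j) (fun j => Y j / Y 0) a Ue.
- by rewrite mxE.
- by rewrite eM.
- by move=> j; exists j; rewrite !mxE.
have [|||N' [b' Eb]] :=
    @kdet_denominator _ e (rev_mx Mp) (\row_j Y (rev_ord j)) (fun j => Y j / Y ord_max) b Ue.
- by rewrite mxE.
- by rewrite map_rev_mx eM.
- move=> j; exists (rev_ord j); rewrite !mxE rev_ordK; congr (_ / Y _).
  by apply: val_inj; rewrite /= subn1.
rewrite -va in Ea; rewrite -vb in Eb.
have detMQ : rho (\det M) = 0.
  by rewrite -det_map_mx rhoM; apply: incidence_det inc (Y0 0).
apply: (pencil_extend ker _ evM detMQ Ea Eb) => p.
by rewrite rmorph_ev; apply: eq_ev => // l; rewrite rhox.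
Qed.

End XChart.

(** * Straightening of the 2 x n minors *)

Section Straightening.
Variables (K : comNzRingType) (n : nat) (I : K -> Prop).
Hypothesis idI : ideal I.
Variable L : 'I_2 -> 'I_n -> K.
Hypothesis minors : forall k l, I (L 0 k * L 1 l - L 0 l * L 1 k).

Let I0 : I 0. Proof. by case: idI. Qed.
Let ID a b : I a -> I b -> I (a + b). Proof. by case: idI => _ + _; apply. Qed.
Let IM a b : I b -> I (a * b). Proof. by case: idI => _ _; apply. Qed.
Let IN a : I a -> I (- a). Proof. by move=> Ia; rewrite -mulN1r; apply: IM. Qed.

Definition Lprod (p q : seq 'I_n) := (\prod_(r <- p) L 0 r) * (\prod_(r <- q) L 1 r).

(** Modulo the minors, the product depends only on the multiset of all column indices and on the
    number of factors from row 0. The induction matches the first index of [p], moving it into row 0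
    of the other product if it is not there. *)
Lemma Lprod_straighten p q p' q' : size p = size p' ->
  perm_eq (p ++ q) (p' ++ q') -> I (Lprod p q - Lprod p' q').
Proof.
elim: p q p' q' => [|x p IH] q p' q'.
  case: p' => // _ /= qq'; rewrite /Lprod (perm_big _ qq') subrr.
  exact: I0.
move=> sp pq.
have main p1 q1 : size p1 = size p -> perm_eq (p ++ q) (p1 ++ q1) ->
    I (Lprod (x :: p) q - Lprod (x :: p1) q1).
  move=> s1 pq1.
  have -> : Lprod (x :: p) q - Lprod (x :: p1) q1 = L 0 x * (Lprod p q - Lprod p1 q1).
    by rewrite /Lprod !big_cons; ring.
  by apply/IM/IH.
have [xp'|xp'] := boolP (x \in p').
  have pp' : perm_eq p' (x :: rem x p') by apply: perm_to_rem.
  have -> : Lprod p' q' = Lprod (x :: rem x p') q'.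
    by rewrite /Lprod (perm_big _ pp').
  apply: main; first by rewrite size_rem // -sp.
  rewrite -(perm_cons x); apply: perm_trans pq _.
  by rewrite -cat_cons perm_cat2r.
have xq' : x \in q'.
  by have := perm_mem pq x; rewrite !mem_cat inE eqxx (negPf xp').
case: p' sp pq xp' => // y p' [sp] pq xp'.
have qq' : perm_eq q' (x :: rem x q') by apply: perm_to_rem.
(* Exchanging [y] in row 0 with [x] in row 1 changes the product by a multiple of one minor. *)
have E : Lprod (y :: p') q' - Lprod (x :: p') (y :: rem x q') =
    (\prod_(r <- p') L 0 r) * (\prod_(r <- rem x q') L 1 r) *
    (L 0 y * L 1 x - L 0 x * L 1 y).
  by rewrite /Lprod (perm_big _ qq') !big_cons /=; ring.
rewrite -[X in I X](subrKA (Lprod (x :: p') (y :: rem x q'))).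
apply: ID; last by rewrite -opprB E; apply/IN/IM/minors.
apply: main; first by rewrite sp.
rewrite -(perm_cons x); apply: perm_trans pq _.
rewrite -[x :: p' ++ _]cat_cons perm_sym.
apply/seq.permP => a; rewrite /= !count_cat /= (seq.permP qq' a) /=; lia.
Qed.

Local Notation T := {mpoly K[n.+1]}.
Implicit Types (m : 'X_{1..n.+1}) (f : T).

(* 'X_ord0 stands for t = x_1 / x_0 and 'X_(lift ord0 k) for L 1 k; as
   L 0 k = - t L 1 k, a monomial whose degree in t is at most its degree in the
   other variables is a product of values of L, unique modulo the minors. *)
Definition mlist m := flatten [seq nseq (m (lift ord0 k)) k | k <- enum 'I_n].

Lemma prod_mlist (c : 'I_n -> K) m :
  \prod_(r <- mlist m) c r = \prod_k c k ^+ m (lift ord0 k).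
Proof.
rewrite /mlist big_flatten big_map big_enum /=; apply: eq_bigr => k _.
by rewrite big_nseq -Monoid.iteropE.
Qed.

Lemma mdeg_mlist m : mdeg m = (m ord0 + size (mlist m))%N.
Proof.
rewrite mdegE big_ord_recl; congr addn.
rewrite size_flatten /shape -map_comp sumnE big_map big_enum /=.
by apply: eq_bigr => k _; rewrite size_nseq.
Qed.

Lemma mlistD m m' : perm_eq (mlist (m + m')) (mlist m ++ mlist m').
Proof.
apply/seq.permP => a; rewrite count_cat !count_flatten !sumnE !(big_enum, big_map) /=.
by rewrite -big_split; apply: eq_bigr => k _; rewrite /= !count_nseq mnmDE mulnDr.
Qed.

(** Each factor t is absorbed by one of the first listed factors [L 1 k], as t times [L 1 k] is
    minus [L 0 k]. This represents the monomial when the exponent of t is at most the length of the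
    list. *)
Definition Lmon m := (-1) ^+ m ord0 * Lprod (take (m ord0) (mlist m)) (drop (m ord0) (mlist m)).

(** As [mdeg] counts t as well, the inequality says that the degree in t exceeds the degree in the
    other variables by at most [N]. *)
Definition good N f := forall m, m \in msupp f -> (2 * m ord0 <= mdeg m + N)%N.

(** Both sides carry the same sign, the same column indices and equally many factors from row 0, so
    straightening applies. *)
Lemma Lmon_mul m m' : (2 * m ord0 <= mdeg m)%N -> (2 * m' ord0 <= mdeg m')%N ->
  I (Lmon (m + m') - Lmon m * Lmon m').
Proof.
rewrite !mdeg_mlist !mul2n -!addnn !leq_add2l => gm gm'.
rewrite /Lmon mnmDE exprD.
set p := take _ (mlist m); set q := drop _ (mlist m).
set p' := take _ (mlist m'); set q' := drop _ (mlist m').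
have -> : (-1) ^+ m ord0 * Lprod p q * ((-1) ^+ m' ord0 * Lprod p' q') =
    (-1) ^+ m ord0 * (-1) ^+ m' ord0 * Lprod (p ++ p') (q ++ q').
  by rewrite /Lprod !big_cat /=; ring.
rewrite -mulrBr; apply/IM/Lprod_straighten.
  have sD := perm_size (mlistD m m'); rewrite size_cat in sD.
  by rewrite size_cat !size_takel // sD leq_add.
rewrite cat_take_drop; apply: perm_trans (mlistD m m') _.
rewrite -[mlist m](cat_take_drop (m ord0)) -[mlist m'](cat_take_drop (m' ord0)).
rewrite -/p -/q -/p' -/q' -!catA perm_cat2l !catA perm_cat2r.
by rewrite perm_catC.
Qed.

Definition straighten f := \sum_(m <- msupp f) f@_m * Lmon m.

Lemma straightenE f b : (msize f <= b)%N ->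
  straighten f = \sum_(m : 'X_{1..n.+1 < b}) f@_m * Lmon m.
Proof.
move=> sf; pose B : subFinType _ := 'X_{1..n.+1 < b}.
rewrite /straighten (big_mksub B) ?msupp_uniq //=; first last.
  by move=> m /msize_mdeg_lt /leq_trans; apply.
by rewrite big_rmcond //= => m /memN_msupp_eq0 ->; rewrite mul0r.
Qed.

Lemma straightenD f f' : straighten (f + f') = straighten f + straighten f'.
Proof.
pose b := maxn (msize (f + f')) (maxn (msize f) (msize f')).
rewrite !(@straightenE _ b) /b ?leq_max ?leqnn ?orbT // -big_split /=.
by apply: eq_bigr => m _; rewrite mcoeffD mulrDl.
Qed.

Lemma straightenZ c f : straighten (c *: f) = c * straighten f.
Proof.
pose b := maxn (msize (c *: f)) (msize f).
rewrite !(@straightenE _ b) /b ?leq_max ?leqnn ?orbT // mulr_sumr.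
by apply: eq_bigr => m _; rewrite mcoeffZ -mulrA.
Qed.

Lemma straightenX m : straighten 'X_[m] = Lmon m.
Proof. by rewrite /straighten msuppX big_seq1 mcoeffX eqxx mul1r. Qed.

Lemma straighten_sum (J : Type) (r : seq J) (F : J -> T) :
  straighten (\sum_(i <- r) F i) = \sum_(i <- r) straighten (F i).
Proof.
elim: r => [|i r IH]; rewrite ?big_nil ?big_cons ?straightenD ?IH //.
by rewrite /straighten msupp0 big_nil.
Qed.

Lemma straightenM f f' : good 0 f -> good 0 f' ->
  I (straighten (f * f') - straighten f * straighten f').
Proof.
move=> gf gf'; rewrite {1}[f]mpolyE {1}[f']mpolyE mulr_suml straighten_sum.
rewrite {2}/straighten mulr_suml -sumrB big_seq.
apply: sum_ideal => // m /gf; rewrite addn0 => gm.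
rewrite mulr_sumr straighten_sum {2}/straighten mulr_sumr -sumrB big_seq.
apply: sum_ideal => // m' /gf'; rewrite addn0 => gm'.
rewrite -scalerAl -scalerAr scalerA straightenZ -mpolyXD straightenX.
have -> : f@_m * Lmon m * (f'@_m' * Lmon m') = f@_m * f'@_m' * (Lmon m * Lmon m') by ring.
by rewrite -mulrBr; apply/IM/Lmon_mul.
Qed.

Lemma goodD N f f' : good N f -> good N f' -> good N (f + f').
Proof.
by move=> gf gf' m /msuppD_le; rewrite mem_cat => /orP[/gf|/gf'].
Qed.

Lemma goodN N f : good N f -> good N (- f).
Proof. by move=> gf m; rewrite (perm_mem (msuppN f)) => /gf. Qed.

Lemma goodM N N' f f' : good N f -> good N' f' -> good (N + N') (f * f').
Proof.
move=> gf gf' m /msuppM_le /allpairsP[[m1 m2] [/= /gf h1 /gf' h2 ->]].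
rewrite mnmDE mdegD; lia.
Qed.

Lemma goodX N m : (2 * m ord0 <= mdeg m + N)%N -> good N 'X_[m].
Proof. by move=> h m'; rewrite msuppX inE => /eqP ->. Qed.

Lemma goodC c : good 0 c%:MP.
Proof.
by move=> m; rewrite msuppC; case: ifP => // _; rewrite inE => /eqP ->; rewrite mnm0E.
Qed.

(** Multiplication by t^N raises the degree in t by exactly [N], which uses up the allowance. *)
Lemma good_mulXn N f : good N ('X_ord0 ^+ N * f) -> good 0 f.
Proof.
move=> gf m mf; have : (U_(ord0) *+ N + m)%MM \in msupp ('X_ord0 ^+ N * f).
  by rewrite mcoeff_msupp mpolyXn mulrC mcoeffMX -mcoeff_msupp.
move=> /gf; rewrite mnmDE mdegD mulmnE mdegMn mdeg1 mnm1E eqxx; lia.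
Qed.

Lemma straightenC c : straighten c%:MP = c.
Proof.
rewrite -[c%:MP]mulr1 mul_mpolyC straightenZ -mpolyX0 straightenX.
rewrite /Lmon mnm0E take0 drop0 /Lprod big_nil prod_mlist big1 ?mulr1 //.
by move=> k _; rewrite mnm0E.
Qed.

End Straightening.

(** * The charts with y_j = 1 *)

Section YChart.
Variables (n : nat) (g : generic_incidence n).
Local Notation Q := (gi_field g).
Local Notation U := (gi_u g).
Local Notation X := (gi_x g).
Local Notation Y := (gi_y g).
Variables (K : idomainType) (u : 'I_2 -> 'I_n.+1 -> 'I_n.+1 -> K).
Variables (y : 'I_n.+1 -> K) (j : 'I_n.+1) (I : K -> Prop).
Hypothesis y_neq0 : forall l, y l != 0.
Definition row_form i k := \sum_l u i l k * y l.
Local Notation L := row_form.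
Hypothesis idI : ideal I.
Hypothesis minors : forall k l, I (L 0 k * L 1 l - L 0 l * L 1 k).
Hypothesis yj1 : I (y j - 1).

Local Notation T := {mpoly K[n.+2]}.
(* A point of the incidence variety whose row forms are - t z_k and z_k, with
   t = 'X_ord0 and z_k = 'X_(lift ord0 k) free. *)
Definition chart_form (i : 'I_2) (k : 'I_n.+1) : T :=
  if i == 0 then - ('X_ord0 * 'X_(lift ord0 k)) else 'X_(lift ord0 k).
Definition chart_x (i : 'I_2) : T := if i == 0 then 1 else 'X_ord0.
Definition chart_y l : T := if l == j then 1 else (y l)%:MP.
(** The coefficients with l = j are solved for, using that coordinate j is 1, so that the row forms
    at [chart_y] become the prescribed [chart_form]. *)
Definition chart_u i l k : T :=
  if l == j then chart_form i k - \sum_(l | l != j) (u i l k)%:MP * (y l)%:MP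
  else (u i l k)%:MP.

Lemma chart_incidence : incidence chart_u chart_x chart_y.
Proof.
have sumE i k : \sum_l chart_u i l k * chart_y l = chart_form i k.
  rewrite (bigD1 j) //= {1}/chart_u {1}/chart_y eqxx mulr1 -[RHS]addr0 -addrA.
  congr (_ + _); rewrite addrC; apply/eqP; rewrite subr_eq0; apply/eqP.
  by apply: eq_bigr => l /negPf lj; rewrite /chart_u /chart_y lj.
move=> k; transitivity (\sum_i chart_x i * chart_form i k).
  apply: eq_bigr => i _; rewrite -sumE mulr_sumr.
  by apply: eq_bigr => l _; rewrite mulrA [chart_x i * _]mulrC.
by rewrite sum_ord2 /chart_x /chart_form /= mul1r addNr.
Qed.

(** The polynomial [f] straightens to [a] modulo [I]. This respects the ring operations because
    straightening is multiplicative modulo [I] on good polynomials. *)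
Let rel (f : T) (a : K) := good 0 f /\ I (straighten L f - a).

Let I0 : I 0. Proof. by case: idI. Qed.
Let ID a b : I a -> I b -> I (a + b). Proof. by case: idI => _ + _; apply. Qed.
Let IM a b : I b -> I (a * b). Proof. by case: idI => _ _; apply. Qed.
Let IN a : I a -> I (- a). Proof. by move=> Ia; rewrite -mulN1r; apply: IM. Qed.

Let relC a : rel a%:MP a.
Proof. by split; [exact: goodC|rewrite straightenC subrr]. Qed.

Let relD f a f' a' : rel f a -> rel f' a' -> rel (f + f') (a + a').
Proof.
move=> [gf If] [gf' If']; split; first exact: goodD.
by rewrite straightenD opprD addrACA; apply: ID.
Qed.

Let relN f a : rel f a -> rel (- f) (- a).
Proof.
move=> [gf If]; split; first exact: goodN.
by rewrite -scaleN1r straightenZ mulN1r -opprD; apply: IN.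
Qed.

Let relM f a f' a' : rel f a -> rel f' a' -> rel (f * f') (a * a').
Proof.
move=> [gf If] [gf' If']; split; first exact: (goodM gf gf').
have -> : straighten L (f * f') - a * a' =
  (straighten L (f * f') - straighten L f * straighten L f') +
  (straighten L f' * (straighten L f - a) + a * (straighten L f' - a')) by ring.
apply: ID; first exact: straightenM.
by apply: ID; apply: IM.
Qed.

Let rel_eq f a a' : rel f a -> I (a - a') -> rel f a'.
Proof.
move=> [gf If] Ia; split=> //.
by rewrite -[X in I X](subrKA a); apply: ID.
Qed.

Let mlist1 (m : 'X_{1..n.+2}) k :
  (forall l, m (lift ord0 l) = (l == k)) -> mlist m = [:: k].
Proof.
move=> mE; have : perm_eq (mlist m) [:: k].
  apply/seq.permP => a; rewrite count_flatten sumnE !(big_enum, big_map) /=.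
  rewrite (bigD1 k) //= big1 => [|l /negPf lk]; last by rewrite count_nseq mE lk muln0.
  by rewrite count_nseq mE eqxx muln1.
by move/perm_small_eq => ->.
Qed.

Let rel_form i k : rel (chart_form i k) (L i k).
Proof.
have lift0 l : (lift ord0 l == ord0 :> 'I_n.+2) = false by [].
have lift0' l : (ord0 == lift ord0 l :> 'I_n.+2) = false by [].
rewrite /chart_form; case: eqP => [->|/eqP i0].
  rewrite -mpolyXD -scaleN1r; split.
    rewrite scaleN1r; apply/goodN/goodX.
    by rewrite mdegD !mdeg1 mnmDE !mnm1E eqxx lift0.
  rewrite straightenZ straightenX /Lmon (@mlist1 _ k) => [|l]; last first.
    by rewrite mnmDE !mnm1E lift0' (inj_eq lift_inj) eq_sym.
  rewrite mnmDE !mnm1E eqxx lift0 /Lprod /= big_seq1 big_nil.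
  by rewrite expr1 mulr1 mulrA mulrNN !mul1r subrr.
have -> : i = 1 by apply: val_inj; case: i i0 => [[|[|i]] li].
split; first by apply: goodX; rewrite mnm1E lift0.
rewrite straightenX /Lmon (@mlist1 _ k) => [|l]; last first.
  by rewrite mnm1E (inj_eq lift_inj) eq_sym.
rewrite mnm1E lift0 /Lprod /= big_seq1 big_nil.
by rewrite !mul1r subrr.
Qed.

Let rel_y l : rel (chart_y l) (y l).
Proof.
rewrite /chart_y; case: eqP => [->|_]; last exact: relC.
rewrite -mpolyC1; apply: rel_eq (relC 1) _.
by rewrite -opprB; apply: IN.
Qed.

Let rel_u i l k : rel (chart_u i l k) (u i l k).
Proof.
rewrite /chart_u; case: eqP => [->|_]; last exact: relC.
apply: (@rel_eq _ (L i k - \sum_(l | l != j) u i l k * y l)).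
  apply: relD; first exact: rel_form.
  apply: relN; elim/big_ind2: _ => [|f a f' a'|l' _].
  - by rewrite -mpolyC0; apply: relC.
  - exact: relD.
  - by apply: relM; apply: relC.
have -> : L i k - \sum_(l | l != j) u i l k * y l - u i j k = u i j k * (y j - 1).
  by rewrite /row_form (bigD1 j) //= addrK; ring.
exact: IM.
Qed.

(** The generic point specializes to the chart point, so [p] vanishes there; straightening carries
    that value to [ev u y p] modulo [I]. *)
Lemma y_chart_kernel p : ev U (fun l => Y l / Y j) p = 0 -> I (ev u y p).
Proof.
move=> p0.
have x0 : chart_x 0 != 0 by rewrite oner_eq0.
have y0 : chart_y 0 != 0.
  rewrite /chart_y; case: ifP => _; first by rewrite oner_eq0.
  apply: contraNneq (y_neq0 0) => /(congr1 (mcoeff 0%MM)).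
  by rewrite mpolyCK mcoeff0 => ->.
have y1 : chart_y j = 1 by rewrite /chart_y eqxx.
have p'0 := gi_specialize_y chart_incidence x0 y0 y1 p0.
have [_] : rel (ev chart_u chart_y p) (ev u y p).
  apply: ev_rel => //.
  by rewrite -mpolyC1; apply: relC.
rewrite p'0 -mpolyC0 straightenC sub0r => /IN; by rewrite opprK.
Qed.

Section Extend.
Variable eta : {rmorphism K -> Q}.
Hypothesis etau : forall i l k, eta (u i l k) = U i l k.
Hypothesis etay : forall l, eta (y l) = Y l / Y j.

Let t : Q := X 1 / X 0.
Let rho : {rmorphism T -> Q} :=
  mmap eta (fun l => if unlift ord0 l is Some k then eta (L 1 k) else t).

Let X0 l : X l != 0 := gi_x_neq0 g l.
Let Y0 l : Y l != 0 := gi_y_neq0 g l.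

Let etaL k : eta (L 0 k) = - t * eta (L 1 k).
Proof.
have := gi_incidence g k; rewrite sum_ord2 => E.
have LE i : eta (L i k) = (\sum_l U i l k * X i * Y l) / (X i * Y j).
  rewrite rmorph_sum mulr_suml; apply: eq_bigr => l _.
  by rewrite rmorphM etau etay; field; rewrite X0 Y0.
rewrite !LE; move/eqP: E; rewrite addr_eq0 => /eqP ->.
by rewrite /t; field; rewrite !X0 Y0.
Qed.

Let rho_form i k : rho (chart_form i k) = eta (L i k).
Proof.
have rz : rho 'X_(lift ord0 k) = eta (L 1 k).
  by rewrite /rho /= mmapX mmap1U liftK.
rewrite /chart_form; case: eqP => [->|/eqP i0].
  rewrite rmorphN rmorphM rz etaL mulNr; congr (- (_ * _)).
  by rewrite /rho /= mmapX mmap1U unlift_none.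
by rewrite rz; congr (eta (L _ _)); apply: val_inj; case: i i0 => [[|[|i]] li].
Qed.

Let rho_u i l k : rho (chart_u i l k) = U i l k.
Proof.
have rC a : rho a%:MP = eta a by apply: mmapC.
rewrite /chart_u; case: eqP => [->|_]; last by rewrite rC etau.
have Erho : rho (\sum_(l' | l' != j) (u i l' k)%:MP * (y l')%:MP) =
    eta (\sum_(l' | l' != j) u i l' k * y l').
  by rewrite !rmorph_sum; apply: eq_bigr => l' _; rewrite !rmorphM; congr (_ * _); apply: rC.
rewrite rmorphB rho_form Erho /row_form (bigD1 j) //= rmorphD addrK.
by rewrite rmorphM etau etay divff ?mulr1.
Qed.

Let rho_x l : rho (chart_x l) = X l / X 0.
Proof.
rewrite /chart_x; case: eqP => [->|/eqP l0]; first by rewrite rmorph1 divff.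
rewrite /rho /= mmapX mmap1U unlift_none /t; congr (X _ / _).
by apply: val_inj; case: l l0 => [[|[|i]] li].
Qed.

(** In [Q] the incidence equations give [L 0 k] as minus t times [L 1 k], so each factor from row 0
    returns one t, and the signs cancel. *)
Lemma rho_straighten f : good 0 f -> rho f = eta (straighten L f).
Proof.
move=> gf; rewrite {1}[f]mpolyE /straighten !rmorph_sum !big_seq.
apply: eq_bigr => m /gf; rewrite addn0 mdeg_mlist => gm.
rewrite /= mmapZ mmapX rmorphM; congr (_ * _).
rewrite /mmap1 big_ord_recl unlift_none.
rewrite (eq_bigr (fun k => eta (L 1 k) ^+ m (lift ord0 k))) => [|k _]; last first.
  by rewrite liftK.
rewrite -(prod_mlist (fun k => eta (L 1 k))) /Lmon /Lprod !rmorphM rmorphXn rmorphN1 /=.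
rewrite !rmorph_prod -[in LHS](cat_take_drop (m ord0) (mlist m)) big_cat /= !mulrA.
congr (_ * _).
have -> : \prod_(r <- take (m ord0) (mlist m)) eta (L 0 r) =
    \prod_(r <- take (m ord0) (mlist m)) (- t * eta (L 1 r)).
  by apply: eq_bigr => r _; rewrite etaL.
rewrite big_split /= mulrA big_const_seq count_predT size_takel; last first.
  by move: gm; rewrite mul2n -addnn leq_add2l.
by rewrite iter_mulr_1 -exprMn mulN1r opprK.
Qed.

(** The coordinate X_0 / X_1 is 1 / t. Clearing N such factors leaves a polynomial whose degree in t
    exceeds the other degree by at most N. *)
Lemma good_numerator (S : comNzRingType) (e : {rmorphism S -> Q})
  (c : {rmorphism S -> T}) (s : S) q :
  (forall i l k, exists r, U i l k = e r /\ good 0 (c r)) ->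
  e s = t -> c s = 'X_ord0 ->
  exists N r, t ^+ N * ev U (fun l => X l / X 1) q = e r /\ good N (c r).
Proof.
move=> Ue es cs.
have good1 : good 0 (1 : T) by rewrite -mpolyC1; apply: goodC.
have goodXn N f N' : good N f -> good (N + N') ('X_ord0 ^+ N' * f).
  move=> gf; rewrite addnC; apply: goodM => //.
  by rewrite mpolyXn; apply: goodX; rewrite mulmnE mdegMn mdeg1 mnm1E eqxx; lia.
apply: (@ev_pred _ (fun w => exists N r, t ^+ N * w = e r /\ good N (c r))).
- by exists 0%N, 1; rewrite mulr1 !rmorph1.
- move=> w [N [r [E gr]]]; exists N, (- r).
  by rewrite mulrN E !rmorphN; split=> //; apply: goodN.
- move=> w w' [N [r [E gr]]] [N' [r' [E' gr']]].
  exists (N + N')%N, (s ^+ N' * r + s ^+ N * r'); split.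
    by rewrite rmorphD !rmorphM !rmorphXn es /= -E -E' exprD; ring.
  rewrite rmorphD !rmorphM !rmorphXn cs /=; apply: goodD; first exact: goodXn.
  by rewrite addnC; apply: goodXn.
- move=> w w' [N [r [E gr]]] [N' [r' [E' gr']]].
  exists (N + N')%N, (r * r'); split; first by rewrite rmorphM /= -E -E' exprD; ring.
  by rewrite rmorphM; apply: goodM.
- by move=> i l k; have [r [-> gr]] := Ue i l k; exists 0%N, r; rewrite mul1r.
- move=> l; have [->|l1] := eqVneq l 1.
    by exists 0%N, 1; rewrite mul1r divff // !rmorph1.
  have -> : l = 0 by apply: val_inj; case: l l1 => [[|[|i]] li].
  (* Here the value is 1 / t: one factor t clears it and leaves the numerator 1. *)
  exists 1%N, 1; rewrite !rmorph1; split; last by move=> m /good1; rewrite addn0 addn1 => /leqW.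
  by rewrite /t expr1 mulrA divfK // divff.
Qed.

(** The identity between t^N times [a] and the numerator holds in [Q]; the kernel condition
    transports it to chart polynomials, where t^N can be cancelled from the degree bound. *)
Lemma good_value (S : comNzRingType) (e : {rmorphism S -> Q})
  (c : {rmorphism S -> T}) (s a : S) q :
  (forall p, e p = 0 -> c p = 0) ->
  (forall i l k, exists r, U i l k = e r /\ good 0 (c r)) ->
  e s = t -> c s = 'X_ord0 -> e a = ev U (fun l => X l / X 1) q -> good 0 (c a).
Proof.
move=> ker Ue es cs Ea; have [N [r [Er gr]]] := good_numerator q Ue es cs.
have /ker/eqP : e (s ^+ N * a - r) = 0.
  by rewrite rmorphB rmorphM rmorphXn /= es Ea Er subrr.
rewrite rmorphB rmorphM rmorphXn /= cs subr_eq0 => /eqP Ec.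
by apply: (@good_mulXn _ _ N); rewrite Ec.
Qed.

(** Regularity for x_0 = 1 makes [v] a polynomial in t and the row forms, regularity for x_1 = 1
    makes that polynomial good, and straightening it removes t. *)
Lemma y_chart_extend v a b :
  v = ev U (fun l => X l / X 0) a -> v = ev U (fun l => X l / X 1) b ->
  exists h, v = eta h.
Proof.
move=> va vb.
have y0 : chart_y 0 != 0.
  rewrite /chart_y; case: ifP => _; first by rewrite oner_eq0.
  apply: contraNneq (y_neq0 0) => /(congr1 (mcoeff 0%MM)).
  by rewrite mpolyCK mcoeff0 => ->.
have x0 : chart_x 0 = 1 by [].
have x0' : chart_x 0 != 0 by rewrite oner_eq0.
pose e : {rmorphism {mpoly (Lambda n.+1)[2]} -> Q} := ev U (fun l => X l / X 0).
pose c : {rmorphism {mpoly (Lambda n.+1)[2]} -> T} := ev chart_u chart_x.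
have ker p : e p = 0 -> c p = 0.
  exact: (gi_specialize_x chart_incidence x0' y0 x0).
have es : e 'X_1 = t by apply: evX.
have cs : c 'X_1 = 'X_ord0 by apply: evX.
have Ue i l k : exists r, U i l k = e r /\ good 0 (c r).
  exists (uvar i l k)%:MP; split; first by symmetry; apply: ev_uvar.
  have -> : c (uvar i l k)%:MP = chart_u i l k by apply: ev_uvar.
  by case: (rel_u i l k).
have ga : good 0 (c a).
  by apply: (good_value ker Ue es cs (q := b)); rewrite -vb va.
have H1 := rmorph_ev rho chart_u chart_x a.
have H2 := @eq_ev Q n.+1 2 (fun i l k => rho (chart_u i l k)) U
  (fun l => rho (chart_x l)) (fun l => X l / X 0) a rho_u rho_x.
have H := etrans va (esym (etrans H1 H2)).
by exists (straighten L (c a)); rewrite -(rho_straighten ga) H.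
Qed.

End Extend.
End YChart.

(** * Comparison inside a field, and the free coordinate rings *)

Lemma sections_rmorphism (R : idomainType) (m m' : nat) (F : seq {mpoly R[m]})
  (F' : seq {mpoly R[m']}) (Q : fieldType) (U : {rmorphism R -> Q})
  (g : global_sections F -> Q) (g' : global_sections F' -> Q) :
  injective g -> g 1 = 1 -> {morph g : s t / s + t} -> {morph g : s t / s * t} ->
  (forall c s, g (c *: s) = U c * g s) ->
  injective g' -> g' 1 = 1 -> {morph g' : s t / s + t} -> {morph g' : s t / s * t} ->
  (forall c s, g' (c *: s) = U c * g' s) ->
  (forall v, (exists s, g s = v) <-> (exists s, g' s = v)) ->
  exists2 phi : {rmorphism global_sections F -> global_sections F'},
    scalable phi & bijective phi.
Proof.
move=> gI g1 gD gM gZ g'I g'1 g'D g'M g'Z img.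
have ex s : exists t, g' t = g s by apply/img; exists s.
have ex' t : exists s, g s = g' t by apply/img; exists t.
(* The two rings have the same image in [Q]: [f] matches sections of equal value, and injectivity of
   the values yields the ring laws. *)
have [f fE] := choice ex; have [f' f'E] := choice ex'.
have fB : GRing.Theory.zmod_morphism f.
  move=> s t; apply/g'I; apply: (addIr (g' (f t))).
  by rewrite -[RHS]g'D subrK !fE -gD subrK.
have fM : GRing.Theory.monoid_morphism f.
  by split=> [|s t]; apply: g'I; rewrite ?g'M !fE ?g1 ?g'1 ?gM.
pose fBm := GRing.isZmodMorphism.Build _ _ f fB.
pose fMm := GRing.isMonoidMorphism.Build _ _ f fM.
pose phi : {rmorphism global_sections F -> global_sections F'} := HB.pack f fBm fMm.
exists phi.
  by move=> c s; apply: g'I; rewrite g'Z /= !fE gZ.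
by exists f' => s; [apply: gI|apply: g'I]; rewrite ?f'E ?fE ?f'E.
Qed.

Definition mpoly_idomain (R : idomainType) m : idomainType := {mpoly R[m]}.

Lemma mpoly_rmorphism (R : idomainType) (T : comNzRingType) m
  (f : {rmorphism R -> T}) (z : 'I_m -> T) :
  exists e : {rmorphism mpoly_idomain R m -> T},
    (forall a, e a%:MP = f a) /\ (forall l, e 'X_l = z l).
Proof.
exists (mmap f z); split=> [a|l]; first exact: mmapC.
by rewrite /= mmapX mmap1U.
Qed.

Lemma mpoly_rmorphism_id (R : idomainType) m
  (e : {rmorphism mpoly_idomain R m -> mpoly_idomain R m}) :
  (forall a, e a%:MP = a%:MP) -> (forall l, e 'X_l = 'X_l) -> e =1 id.
Proof.
move=> eC eX p; rewrite -[in LHS](mmap_id p) -[RHS](mmap_id p).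
by apply: rmorph_mmap => [a|l]; [exact: eC|exact: eX].
Qed.

Lemma exists_incidence n : generic_incidence n.
Proof.
pose u i j k : {mpoly (Lambda n.+1)[2 + n.+1]} := (uvar i j k)%:MP.
apply: (@exists_generic_incidence n {mpoly (Lambda n.+1)[2 + n.+1]} u
  (fun l => 'X_(lshift n.+1 l)) (fun j => 'X_(rshift 2 j))).
- by move=> l; rewrite -msize_poly_eq0 msizeX.
- by move=> l; rewrite -msize_poly_eq0 msizeX.
move=> T u' x' y'.
pose z t := match split t with inl l => x' l | inr j => y' j end.
have [e [eC eX]] := mpoly_rmorphism (evL u') z.
exists e; split=> [i j k|l|j]; first exact: etrans (eC _) (evL_uvar _ _ _ _).
- by apply: etrans (eX _) _; rewrite /z (unsplitK (inl l)).
- by apply: etrans (eX _) _; rewrite /z (unsplitK (inr j)).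
Qed.

Lemma horner0_perturb (R : comNzRingType) (b : bool) (c : R) (p : {poly R}) :
  (c%:P + (if b then 'X * p else 0)).[0] = c.
Proof.
rewrite hornerD hornerC; case: b; last by rewrite horner0 addr0.
by rewrite hornerM hornerX mul0r addr0.
Qed.

Section XCoordinates.
Variables (n : nat) (R : idomainType) (u : 'I_2 -> 'I_n.+1 -> 'I_n.+1 -> R).
Variables (z : 'I_2 -> R) (i : 'I_2).
Hypothesis free_ex : forall (T : comNzRingType) u' z', exists e : {rmorphism R -> T},
  (forall l j k, e (u l j k) = u' l j k) /\ (forall l, e (z l) = z' l).
Hypothesis free_id : forall e : {rmorphism R -> R},
  (forall l j k, e (u l j k) = u l j k) -> (forall l, e (z l) = z l) -> e =1 id.

(** The coordinate is set to 1 in the point and not by a quotient of the ring, so the ring stays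
    freely generated. *)
Definition affine_coord (T : nzRingType) m (w : 'I_m -> T) (i l : 'I_m) : T :=
  if l == i then 1 else w l.
Local Notation x := (affine_coord z i).

(** Adding X times [B] to the i-th coefficient matrix moves the whole pencil by X times [B], since
    its i-th coordinate is 1. At X = 0 the morphism fixes the generators, hence is the identity. *)
Lemma exists_deformation (B : 'M[{poly R}]_n.+1) :
  exists tau : {rmorphism R -> {poly R}}, (forall r, (tau r).[0] = r) /\
    map_mx tau (pencil u x) = map_mx polyC (pencil u x) + 'X *: B.
Proof.
have [tau [tauu tauz]] := free_ex
  (fun l j k => (u l j k)%:P + (if l == i then 'X * B j k else 0)) (fun l => (z l)%:P).
exists tau; split.
  apply: (free_id (e := horner_eval (0 : R) \o tau)) => [l j k|l] /=.
    by rewrite tauu /horner_eval horner0_perturb.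
  by rewrite tauz /horner_eval hornerC.
apply/matrixP => j k; rewrite !mxE !rmorph_sum -['X * _](_ : \sum_l
    (if l == i then 'X * B j k else 0) = _); last by rewrite -big_mkcond /= big_pred1_eq.
rewrite -big_split /=; apply: eq_bigr => l _.
rewrite !rmorphM tauu mulrDr /affine_coord; congr (_ + _).
  by case: eqP => _; rewrite ?tauz ?rmorph1.
by case: eqP => _; rewrite ?rmorph1 ?mul1r ?mulr0.
Qed.

Lemma exists_shift_point :
  exists xi : {rmorphism R -> int}, map_mx xi (pencil u x) = (shift_mx n int)^T.
Proof.
have [xi [xiu xiz]] := free_ex
  (fun l j k => if l == i then (shift_mx n int)^T j k else 0) (fun=> 0).
exists xi; apply/matrixP => j k; rewrite mxE mxE rmorph_sum (bigD1 i) //= big1.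
  by rewrite addr0 rmorphM /affine_coord eqxx rmorph1 mul1r xiu eqxx.
by move=> l /negPf li; rewrite rmorphM xiu li mulr0.
Qed.

Lemma affine_coord_neq0 l : x l != 0.
Proof.
rewrite /affine_coord; case: ifP => _; first by rewrite oner_eq0.
have [e [_ ez]] := @free_ex int (fun _ _ _ => 0) (fun=> 1).
by apply/eqP => z0; have := ez l; rewrite z0 rmorph0.
Qed.

Lemma affine_coord1 : x i = 1. Proof. by rewrite /affine_coord eqxx. Qed.

Variable g : generic_incidence n.
Local Notation Q := (gi_field g).
Local Notation U := (gi_u g).
Local Notation X := (gi_x g).
Local Notation Y := (gi_y g).

Lemma x_kernel p : ev U (fun l => X l / X i) p = 0 ->
  exists s, ev u x p = \det (pencil u x) * s.
Proof.
have [tau [tau0 tauM]] := exists_deformation 1%:M; rewrite scalemx1 in tauM.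
have [tau' [_ tau'M]] := exists_deformation (shift_mx n _).
exact: (x_chart_kernel affine_coord1 (affine_coord_neq0 0) tau0 tauM tau'M).
Qed.

Lemma x_extend (rho : {rmorphism R -> Q}) v a b :
  (forall l j k, rho (u l j k) = U l j k) -> (forall l, rho (z l) = X l / X i) ->
  v = ev U (fun j => Y j / Y 0) a -> v = ev U (fun j => Y j / Y ord_max) b ->
  exists r, v = rho r.
Proof.
move=> rhou rhoz.
have [tau [tau0 tauM]] := exists_deformation 1%:M; rewrite scalemx1 in tauM.
have [tau' [tau'0 tau'M]] := exists_deformation (shift_mx n _).
have [xi xiM] := exists_shift_point.
apply: (x_chart_extend affine_coord1 (affine_coord_neq0 0) tau0 tau'0 tauM tau'M xiM) => // l.
rewrite /affine_coord; case: eqP => [->|_] //.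
by rewrite rmorph1 divff // gi_x_neq0.
Qed.

End XCoordinates.

(** * The two schemes *)

Lemma chart_ideal (R : comNzRingType) m (F : seq {mpoly R[m]}) j :
  ideal (fun a => exists b c, ideal_gen F b /\ a = b + ('X_j - 1) * c).
Proof.
split.
- by exists 0, 0; rewrite mulr0 addr0; split=> //; apply: ideal_gen0.
- move=> a b [a1 [a2 [Fa ->]]] [b1 [b2 [Fb ->]]].
  by exists (a1 + b1), (a2 + b2); split; [exact: ideal_genD|ring].
- move=> a b [b1 [b2 [Fb ->]]].
  by exists (a * b1), (a * b2); split; [exact: ideal_genM|ring].
Qed.

Lemma dehomog_mod (R : idomainType) m (i : 'I_m) (p : {mpoly R[m]}) :
  exists c, p - mmap (@mpolyC m R) (affine_coord (fun l => 'X_l) i) p = ('X_i - 1) * c.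
Proof.
rewrite -{1}[p]mmap_id.
apply: (@mmap_rel _ _ (fun a b => exists c, a - b = ('X_i - 1) * c)).
- by exists 0; rewrite subrr mulr0.
- by move=> a b [c E]; exists (- c); rewrite mulrN -E; ring.
- by move=> a b a' b' [c E] [c' E']; exists (c + c'); rewrite mulrDr -E -E'; ring.
- move=> a b a' b' [c E] [c' E']; exists (c * a' + b * c').
  by rewrite mulrDr mulrA -E mulrCA -E'; ring.
- by move=> a; exists 0; rewrite subrr mulr0.
- move=> l; rewrite /affine_coord; case: eqP => [->|_]; last by exists 0; rewrite subrr mulr0.
  by exists 1; rewrite mulr1.
Qed.

(** Both [p] and [d] agree with their dehomogenizations modulo [X_i - 1]. *)
Lemma dehomog_ideal (R : idomainType) m (i : 'I_m) (d s p : {mpoly R[m]}) :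
  let e := mmap (@mpolyC m R) (affine_coord (fun l => 'X_l) i) in
  e p = e d * s -> exists b c, ideal_gen [:: d] b /\ p = b + ('X_i - 1) * c.
Proof.
move=> e E; have [c1 E1] := dehomog_mod i p; have [c2 E2] := dehomog_mod i d.
exists (s * d), (c1 - s * c2); split.
  by apply/ideal_genM/ideal_gen_mem; rewrite mem_seq1.
rewrite mulrBr -E1 mulrCA -E2 -/(e p) E; ring.
Qed.

Lemma det_homog (R : comNzRingType) m n (A : 'M[{mpoly R[m]}]_n) :
  (forall j k, A j k \is 1.-homog) -> \det A \is n.-homog.
Proof.
move=> hA; apply: rpred_sum => s _; rewrite mulr_sign.
suff h : \prod_i A i (s i) \is n.-homog by case: ifP => _; rewrite ?rpredN.
rewrite -[X in X.-homog]card_ord -sum1_card.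
by apply: (big_ind2 (fun d p => p \is d.-homog)) => [|d p e q|i _]; [exact: dhomog1|exact: dhomogM|].
Qed.

Section Equations.
Variables (R : comNzRingType) (n : nat) (u : 'I_2 -> 'I_n -> 'I_n -> R).

Definition gen_pencil : 'M[{mpoly R[2]}]_n :=
  pencil (fun l j k => (u l j k)%:MP) (fun l => 'X_l).

Definition gen_form i k : {mpoly R[n]} := \sum_j u i j k *: 'X_j.

Definition gen_minors : seq {mpoly R[n]} :=
  [seq gen_form 0 kl.1 * gen_form 1 kl.2 - gen_form 0 kl.2 * gen_form 1 kl.1
     | kl : 'I_n * 'I_n <- enum {: 'I_n * 'I_n} & (kl.1 < kl.2)%N].

Lemma mmap_gen_pencil (T : comNzRingType) (f : {rmorphism R -> T}) u' (x : 'I_2 -> T) :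
  (forall l j k, f (u l j k) = u' l j k) ->
  mmap f x (\det gen_pencil) = \det (pencil u' x).
Proof.
move=> fu; have <- : map_mx (mmap f x) gen_pencil = pencil u' x.
  apply: map_pencil => [l j k|l] /=; last by rewrite mmapX mmap1U.
  by rewrite mmapC; apply: fu.
exact: esym (det_map_mx (mmap f x) gen_pencil).
Qed.

Lemma gen_pencil_homog : \det gen_pencil \is n.-homog.
Proof.
apply: det_homog => j k; rewrite mxE; apply: rpred_sum => l _.
rewrite mulrC mul_mpolyC; apply: rpredZ.
exact: mpolyX_homog.
Qed.

Lemma mmap_gen_form (T : comNzRingType) (f : {rmorphism R -> T}) u' (y : 'I_n -> T) i k :
  (forall l j k, f (u l j k) = u' l j k) ->
  mmap f y (gen_form i k) = \sum_j u' i j k * y j.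
Proof.
move=> fu; rewrite rmorph_sum; apply: eq_bigr => l _.
by rewrite /= mmapZ mmapX mmap1U fu.
Qed.

Lemma gen_minorsP f : f \in gen_minors -> exists k l,
  f = gen_form 0 k * gen_form 1 l - gen_form 0 l * gen_form 1 k.
Proof. by case/mapP => -[k l] _ ->; exists k, l. Qed.

(** The list contains the minors with k < l; antisymmetry gives the others. *)
Lemma gen_minors_ideal k l :
  ideal_gen gen_minors (gen_form 0 k * gen_form 1 l - gen_form 0 l * gen_form 1 k).
Proof.
have lt (a b : 'I_n) : (a < b)%N ->
    ideal_gen gen_minors (gen_form 0 a * gen_form 1 b - gen_form 0 b * gen_form 1 a).
  move=> ab; apply: ideal_gen_mem; apply/mapP; exists (a, b) => //.
  by rewrite mem_filter mem_enum /= ab.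
case: (ltngtP k l) => [/lt //|lk|/val_inj ->]; last by rewrite subrr; apply: ideal_gen0.
by rewrite -opprB -mulN1r; apply/ideal_genM/lt.
Qed.

Lemma gen_minors_homog f : f \in gen_minors -> f \is 2.-homog.
Proof.
move=> /gen_minorsP[k [l ->]].
have h i a : gen_form i a \is 1.-homog.
  by apply: rpred_sum => j _; apply/rpredZ/mpolyX_homog.
by apply: rpredB; apply: (dhomogM (h _ _) (h _ _)).
Qed.

End Equations.

Section Sections.
Variables (n : nat) (g : generic_incidence n).
Local Notation Q := (gi_field g).
Local Notation U := (gi_u g).
Local Notation X := (gi_x g).
Local Notation Y := (gi_y g).
Variables (R : idomainType) (u : 'I_2 -> 'I_n.+1 -> 'I_n.+1 -> R).
Hypothesis u_univ : forall (T : comNzRingType) u',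
  exists f : {rmorphism R -> T}, forall l j k, f (u l j k) = u' l j k.
Hypothesis u_surj : forall a : R, exists b : Lambda n.+1, a = evL u b.

(** Coefficients are lifted along the surjection [evL u], so that the results on [ev] apply to
    polynomials over [R]. *)
Lemma mpoly_lift m (p : {mpoly R[m]}) : exists q : {mpoly (Lambda n.+1)[m]},
  forall (T : comNzRingType) (f : {rmorphism R -> T}) u' x,
    (forall l j k, f (u l j k) = u' l j k) -> mmap f x p = ev u' x q.
Proof.
elim/mpolyind: p => [|c t p _ _ [q E]].
  by exists 0 => T f u' x _; rewrite mmap0 rmorph0.
have [b Ec] := u_surj c; exists (b *: 'X_[t] + q) => T f u' x fu.
rewrite mmapD mmapZ mmapX (E _ _ _ _ fu) rmorphD /= evZ; congr (_ * _ + _).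
  by rewrite Ec; apply: rmorph_evL.
by rewrite /ev mmapX.
Qed.

Local Notation S m := (mpoly_idomain R m).
Let gu m l j k : S m := (u l j k)%:MP.

Let free_ex m (T : comNzRingType) u' (z' : 'I_m -> T) :
  exists e : {rmorphism S m -> T},
    (forall l j k, e (gu m l j k) = u' l j k) /\ (forall l, e 'X_l = z' l).
Proof.
have [f fu] := u_univ u'; have [e [eC eX]] := mpoly_rmorphism f z'.
by exists e; split=> [l j k|l]; rewrite ?eX // eC fu.
Qed.

Let free_id m (e : {rmorphism S m -> S m}) :
  (forall l j k, e (gu m l j k) = gu m l j k) -> (forall l, e 'X_l = 'X_l) -> e =1 id.
Proof.
move=> eu; apply: mpoly_rmorphism_id => a; have [b ->] := u_surj a.
have E : (evL u b)%:MP = evL (gu m) b :> S m by apply: rmorph_evL.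
by rewrite E; apply: rmorph_evL.
Qed.

Let X_neq0 m l : 'X_l != 0 :> S m.
Proof. by rewrite -msize_poly_eq0 msizeX. Qed.

Variable f : {rmorphism R -> Q}.
Hypothesis fu : forall l j k, f (u l j k) = U l j k.

Lemma pencil_kernel i p : mmap f (fun l => X l / X i) p = 0 ->
  exists b c, ideal_gen [:: \det (gen_pencil u)] b /\ p = b + ('X_i - 1) * c.
Proof.
have [q E] := mpoly_lift p; rewrite (E _ _ _ _ fu) => q0.
have [s Es] := @x_kernel n (S 2) (gu 2) (fun l => 'X_l) i (@free_ex 2) (@free_id 2) g q q0.
apply: (@dehomog_ideal _ _ _ _ s).
rewrite (E _ _ (gu 2)) // Es; congr (_ * _); apply: esym.
exact: mmap_gen_pencil.
Qed.

Lemma pencil_vanish : mmap f X (\det (gen_pencil u)) = 0.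
Proof.
by rewrite (mmap_gen_pencil _ fu); apply: incidence_det (gi_incidence g) (gi_y_neq0 g 0).
Qed.

(** The incidence equations make the two rows of C(y) proportional. *)
Lemma minors_vanish h : h \in gen_minors u -> mmap f Y h = 0.
Proof.
move=> /gen_minorsP[k [l ->]].
rewrite rmorphB !rmorphM /= !(mmap_gen_form _ _ _ fu).
have X0 := gi_x_neq0 g.
have E a : X 0 * (\sum_l U 0 l a * Y l) = - (X 1 * (\sum_l U 1 l a * Y l)).
  apply/eqP; rewrite -addr_eq0; apply/eqP; rewrite -[RHS](gi_incidence g a).
  rewrite sum_ord2 !mulr_sumr.
  by congr (_ + _); apply: eq_bigr => b _; ring.
by apply: (mulfI (X0 0)); rewrite mulrBr !mulrA !E; ring.
Qed.

Let I j (a : S n.+1) := exists b c, ideal_gen (gen_minors u) b /\ a = b + ('X_j - 1) * c.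

Let I_minors j k l :
  I j (row_form (gu n.+1) (fun l => 'X_l) 0 k * row_form (gu n.+1) (fun l => 'X_l) 1 l -
       row_form (gu n.+1) (fun l => 'X_l) 0 l * row_form (gu n.+1) (fun l => 'X_l) 1 k).
Proof.
have E i a : row_form (gu n.+1) (fun l => 'X_l) i a = gen_form u i a.
  by apply: eq_bigr => b _; apply: mul_mpolyC.
rewrite !E; exists (gen_form u 0 k * gen_form u 1 l - gen_form u 0 l * gen_form u 1 k), 0.
by rewrite mulr0 addr0; split=> //; apply: gen_minors_ideal.
Qed.

Let I_unit j : I j ('X_j - 1).
Proof. by exists 0, 1; rewrite add0r mulr1; split=> //; apply: ideal_gen0. Qed.

Lemma minors_kernel j p : mmap f (fun l => Y l / Y j) p = 0 ->
  exists b c, ideal_gen (gen_minors u) b /\ p = b + ('X_j - 1) * c.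
Proof.
have [q E] := mpoly_lift p; rewrite (E _ _ _ _ fu) => q0.
have : I j (ev (gu n.+1) (fun l => 'X_l) q).
  exact: (y_chart_kernel (@X_neq0 n.+1) (chart_ideal _ j) (I_minors j) (I_unit j) q0).
by rewrite -(E _ (@mpolyC n.+1 R)) // mmap_id.
Qed.

(** From x to y both x-charts are used, and every y-chart is reached; from y to x the first and the
    last y-chart are enough. *)
Lemma regular_x_y v :
  (forall i, exists h, v = mmap f (fun l => X l / X i) h) <->
  (forall j, exists h, v = mmap f (fun l => Y l / Y j) h).
Proof.
split=> [hx j|hy i].
  have [a va] := hx 0; have [b vb] := hx 1.
  have [a' Ea] := mpoly_lift a; have [b' Eb] := mpoly_lift b.
  rewrite (Ea _ _ _ _ fu) in va; rewrite (Eb _ _ _ _ fu) in vb.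
  apply: (@y_chart_extend n g (S n.+1) (gu n.+1) (fun l => 'X_l) j (I j)
    (@X_neq0 n.+1) (chart_ideal _ j) (I_minors j) (I_unit j)
    (mmap f (fun l => Y l / Y j)) _ _ v a' b' va vb) => [l k i|l].
    by rewrite -fu; apply: mmapC.
  by rewrite /= mmapX mmap1U.
have [a va] := hy 0; have [b vb] := hy ord_max.
have [a' Ea] := mpoly_lift a; have [b' Eb] := mpoly_lift b.
rewrite (Ea _ _ _ _ fu) in va; rewrite (Eb _ _ _ _ fu) in vb.
apply: (@x_extend n (S 2) (gu 2) (fun l => 'X_l) i (@free_ex 2) (@free_id 2) g
  (mmap f (fun l => X l / X i)) v a' b' _ _ va vb) => [l j k|l].
  by rewrite -fu; apply: mmapC.
by rewrite /= mmapX mmap1U.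
Qed.

Theorem sections_isomorphism :
  exists2 phi : {rmorphism global_sections (gen_minors u) ->
                           global_sections [:: \det (gen_pencil u)]},
    scalable phi & bijective phi.
Proof.
have hy : forall h, h \in gen_minors u -> exists d, h \is d.-homog.
  by move=> h /gen_minors_homog; exists 2%N.
have hx : forall h, h \in [:: \det (gen_pencil u)] -> exists d, h \is d.-homog.
  by move=> h; rewrite mem_seq1 => /eqP ->; exists n.+1; apply: gen_pencil_homog.
have vx h : h \in [:: \det (gen_pencil u)] -> mmap f X h = 0.
  by rewrite mem_seq1 => /eqP ->; apply: pencil_vanish.
have [gy [gyI [gy1 gyD] gyM gyZ gyE]] :=
  global_sections_field hy (gi_y_neq0 g) 0 minors_vanish minors_kernel.
have [gx [gxI [gx1 gxD] gxM gxZ gxE]] :=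
  global_sections_field hx (gi_x_neq0 g) 0 vx pencil_kernel.
apply: (sections_rmorphism gyI gy1 gyD gyM gyZ gxI gx1 gxD gxM gxZ) => v.
by rewrite gyE gxE; apply: iff_sym; apply: regular_x_y.
Qed.

End Sections.

Lemma gen_minors_uvar n : gen_minors (@uvar n) = minors2 n.
Proof. by apply: eq_map => -[k l]; rewrite !mxE. Qed.

Lemma det_gen_pencil_uvar n : \det (gen_pencil (@uvar n)) = cdet n.
Proof.
congr (\det _); apply/matrixP => j k; rewrite mxE summxE.
by apply: eq_bigr => l _; rewrite !mxE.
Qed.

Theorem theorem7p2 (n : nat) (hn : (2 <= n)%N) :
  exists2 phi : {rmorphism sections_TCy n -> sections_TCx n},
    scalable phi & bijective phi.
Proof.
case: n hn => // n _; rewrite /sections_TCx -det_gen_pencil_uvar /sections_TCy -gen_minors_uvar.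
have g := exists_incidence n.
have univ (T : comNzRingType) u' : exists f : {rmorphism Lambda n.+1 -> T},
    forall l j k, f (uvar l j k) = u' l j k.
  by exists (evL u') => i j k; apply: evL_uvar.
have [f fu] := univ _ (gi_u g).
apply: (@sections_isomorphism n g (Lambda n.+1) (@uvar n.+1) univ _ f fu) => a.
by exists a; rewrite evL_id.
Qed.
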